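(* Consider the system \[ \begin{aligned} \dot T(t)&= s-dT(t)+aT(t)\Big(1-\frac{T(t)+I(t)}{T_{\max}}\Big)-\frac{bT(t)V(t)}{1+\alpha V(t)},\\ \dot I(t)&= \frac{bT(t-\tau)V(t-\tau)}{1+\alpha V(t-\tau)}+aI(t)\Big(1-\frac{T(t)+I(t)}{T_{\max}}\Big)-\mu I(t),\\ \dot V(t)&= pI(t)-cV(t), \end{aligned} \] with positive constants $s,d,a,T_{\max},b,\alpha,\mu,p,c$ and $\tau\ge0$, and let $E_2=(T_2,I_2,V_2)$ be an infected equilibrium ($T_2,I_2,V_2>0$). Let $a_2,a_1,a_0,b_1,b_0,A,B,C,\Delta,z_1,\tau_0$ be as defined below, and suppose $a_0+b_0>0$ and $a_2(a_1+b_1)-(a_0+b_0)>0$. (a) If $C\ge0$ and $\Delta=A^2-3B<0$, then all roots of $\lambda^3+a_2\lambda^2+a_1\lambda+a_0+(b_1\lambda+b_0)e^{-\lambda\tau}=0$ have negative real parts for all $\tau\ge0$, so $E_2$ is locally asymptotically stable for all $\tau\ge0$. (b) If $C<0$, or if $C\ge0$, $z_1>0$ and $z_1^3+Az_1^2+Bz_1+C\le0$, then all roots of that equation have negative real parts when $\tau\in[0,\tau_0)$, so $E_2$ is locally asymptotically stable for $\tau\in[0,\tau_0)$.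
   Context: Set $\beta=\frac{bV_2}{1+\alpha V_2}$, $k=\frac{aT_2}{T_{\max}}$, $q=\frac{aI_2}{T_{\max}}$, $m=\frac{bT_2}{(1+\alpha V_2)^2}$, $\kappa=\frac{pI_2}{V_2}$, $\rho=d-a+\frac{a(T_2+I_2)}{T_{\max}}$, $A_{11}=\rho+k+\beta$, $A_{22}=\frac{bT_2V_2}{(1+\alpha V_2)I_2}+q$, $a_2=A_{11}+A_{22}+\kappa$, $a_1=A_{11}A_{22}+\kappa A_{11}+\kappa A_{22}-kq$, $a_0=\kappa A_{11}A_{22}-\kappa kq-pqm$, $b_1=\beta k-pm$, $b_0=\beta k\kappa+\beta pm-pmA_{11}$; with these, the characteristic equation of the linearization at $E_2$ is $\lambda^3+a_2\lambda^2+a_1\lambda+a_0+(b_1\lambda+b_0)e^{-\lambda\tau}=0$. Let $A=a_2^2-2a_1$, $B=a_1^2-2a_2a_0-b_1^2$, $C=a_0^2-b_0^2$, $\Delta=A^2-3B$, and, when $\Delta\ge0$, $z_1=\frac{-A+\sqrt{\Delta}}{3}$ (the condition $z_1>0$ includes that $\Delta\ge0$). When $z^3+Az^2+Bz+C=0$ has a positive root, let $z_0$ be its smallest positive root, $\omega_0=\sqrt{z_0}$, and \[ \tau_0=\frac{1}{\omega_0}\arccos\Big[\frac{b_0(a_2\omega_0^2-a_0)+b_1\omega_0(\omega_0^3-a_1\omega_0)}{b_0^2+b_1^2\omega_0^2}\Big]. \] *)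

(* Defs.v *)
From Stdlib Require Import Reals.
From Coquelicot Require Import Coquelicot.
Open Scope R_scope.

Definition Cexp (z : C) : C :=
  (exp (Re z) * cos (Im z), exp (Re z) * sin (Im z)).

Definition cbeta (d a Tmax b alpha p T2 I2 V2 : R) := b * V2 / (1 + alpha * V2).
Definition ck (d a Tmax b alpha p T2 I2 V2 : R) := a * T2 / Tmax.
Definition cq (d a Tmax b alpha p T2 I2 V2 : R) := a * I2 / Tmax.
Definition cm (d a Tmax b alpha p T2 I2 V2 : R) := b * T2 / (1 + alpha * V2) ^ 2.
Definition ckappa (d a Tmax b alpha p T2 I2 V2 : R) := p * I2 / V2.
Definition crho (d a Tmax b alpha p T2 I2 V2 : R) := d - a + a * (T2 + I2) / Tmax.
Definition A11 (d a Tmax b alpha p T2 I2 V2 : R) := (crho d a Tmax b alpha p T2 I2 V2) + (ck d a Tmax b alpha p T2 I2 V2) + (cbeta d a Tmax b alpha p T2 I2 V2).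
Definition A22 (d a Tmax b alpha p T2 I2 V2 : R) := b * T2 * V2 / ((1 + alpha * V2) * I2) + (cq d a Tmax b alpha p T2 I2 V2).
Definition ca2 (d a Tmax b alpha p T2 I2 V2 : R) := (A11 d a Tmax b alpha p T2 I2 V2) + (A22 d a Tmax b alpha p T2 I2 V2) + (ckappa d a Tmax b alpha p T2 I2 V2).
Definition ca1 (d a Tmax b alpha p T2 I2 V2 : R) := (A11 d a Tmax b alpha p T2 I2 V2) * (A22 d a Tmax b alpha p T2 I2 V2) + (ckappa d a Tmax b alpha p T2 I2 V2) * (A11 d a Tmax b alpha p T2 I2 V2) + (ckappa d a Tmax b alpha p T2 I2 V2) * (A22 d a Tmax b alpha p T2 I2 V2) - (ck d a Tmax b alpha p T2 I2 V2) * (cq d a Tmax b alpha p T2 I2 V2).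
Definition ca0 (d a Tmax b alpha p T2 I2 V2 : R) := (ckappa d a Tmax b alpha p T2 I2 V2) * (A11 d a Tmax b alpha p T2 I2 V2) * (A22 d a Tmax b alpha p T2 I2 V2) - (ckappa d a Tmax b alpha p T2 I2 V2) * (ck d a Tmax b alpha p T2 I2 V2) * (cq d a Tmax b alpha p T2 I2 V2) - p * (cq d a Tmax b alpha p T2 I2 V2) * (cm d a Tmax b alpha p T2 I2 V2).
Definition cb1 (d a Tmax b alpha p T2 I2 V2 : R) := (cbeta d a Tmax b alpha p T2 I2 V2) * (ck d a Tmax b alpha p T2 I2 V2) - p * (cm d a Tmax b alpha p T2 I2 V2).
Definition cb0 (d a Tmax b alpha p T2 I2 V2 : R) := (cbeta d a Tmax b alpha p T2 I2 V2) * (ck d a Tmax b alpha p T2 I2 V2) * (ckappa d a Tmax b alpha p T2 I2 V2) + (cbeta d a Tmax b alpha p T2 I2 V2) * p * (cm d a Tmax b alpha p T2 I2 V2) - p * (cm d a Tmax b alpha p T2 I2 V2) * (A11 d a Tmax b alpha p T2 I2 V2).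

Definition cA (a2 a1 : R) := a2 ^ 2 - 2 * a1.
Definition cB (a2 a1 a0 b1 : R) := a1 ^ 2 - 2 * a2 * a0 - b1 ^ 2.
Definition cC (a0 b0 : R) := a0 ^ 2 - b0 ^ 2.
Definition cDelta (A B : R) := A ^ 2 - 3 * B.
Definition cz1 (A Delta : R) := (- A + sqrt Delta) / 3.
Definition hcubic (A B C z : R) := z ^ 3 + A * z ^ 2 + B * z + C.

Definition charf (a2 a1 a0 b1 b0 tau : R) (l : C) : C :=
  (l * l * l + RtoC a2 * (l * l) + RtoC a1 * l + RtoC a0
   + (RtoC b1 * l + RtoC b0) * Cexp (- (l * RtoC tau)))%C.

Definition all_roots_neg (a2 a1 a0 b1 b0 tau : R) : Prop :=
  forall l : C, charf a2 a1 a0 b1 b0 tau l = 0%C -> Re l < 0.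

Definition tau0_of (a2 a1 a0 b1 b0 w0 : R) : R :=
  / w0 * acos ((b0 * (a2 * w0 ^ 2 - a0) + b1 * w0 * (w0 ^ 3 - a1 * w0))
               / (b0 ^ 2 + b1 ^ 2 * w0 ^ 2)).

(* Main.v *)
(** At [tau = 0] the characteristic equation is the cubic
    [l^3 + a2 l^2 + (a1 + b1) l + (a0 + b0)], stable by the Routh-Hurwitz
    conditions.  As [tau] grows, roots can reach the closed right half-plane
    only by crossing the imaginary axis: stability is an open condition in
    [tau] (such roots are bounded and the characteristic function is Lipschitz
    in [tau] on bounded sets), and a root with positive real part survives
    small changes of [tau] by a Rouche-type argument.  Both rest on the minimum
    modulus principle, valid because the characteristic function has a
    nonvanishing leading Taylor term at every point.

    A root [i w] forces [w^2] to be a positive root of [z^3 + A z^2 + B z + C]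
    and [cos (w tau)] to equal the argument of [acos] in [tau0].  In case (a)
    that cubic is positive on [(0, oo)].  In case (b) the equilibrium relations
    give [A > 0] and make [C >= 0] imply [B >= 0], hence [z1 <= 0]: only
    [C < 0] remains, where the positive root [z0] is unique and no crossing occurs before [tau0]. *)

Require Import Defs.
From Stdlib Require Import Reals Lra Lia Psatz Factorial List Classical ClassicalEpsilon.
From Coquelicot Require Import Coquelicot.
Import ListNotations.
Open Scope R_scope.

Lemma exp_le_compat (x y : R) : x <= y -> exp x <= exp y.
Proof.
  intros [H | ->]; [apply Rlt_le, exp_increasing, H | apply Rle_refl].
Qed.

Lemma Rle_pow_le_1 (x : R) (k j : nat) : 0 <= x <= 1 -> (k <= j)%nat -> x ^ j <= x ^ k.
Proof.
  intros Hx Hkj; replace j with (k + (j - k))%nat by lia; rewrite pow_add.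
  rewrite <- (Rmult_1_r (x ^ k)) at 2.
  apply Rmult_le_compat_l; [apply pow_le; lra |].
  rewrite <- (pow1 (j - k)); apply pow_incr; lra.
Qed.

Lemma exists_pos_lt2 (x y : R) : 0 < x -> 0 < y -> exists t, 0 < t /\ t < x /\ t < y.
Proof.
  intros Hx Hy; exists (Rmin x y / 2).
  pose proof (Rmin_l x y); pose proof (Rmin_r x y); pose proof (Rmin_pos x y Hx Hy); lra.
Qed.

Lemma exists_pos_small_delta (L m : R) : 0 < L -> 0 < m ->
  exists delta, 0 < delta /\ forall d, 0 <= d < delta -> d <= 1 /\ L * d < m / 2.
Proof.
  intros HL Hm; destruct (exists_pos_lt2 1 (m / (2 * L)) Rlt_0_1
                           ltac:(apply Rdiv_lt_0_compat; lra)) as [delta [Hd [Hd1 HdL]]].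
  exists delta; split; [exact Hd |]; intros d [Hd0 Hdd]; split; [lra |].
  apply Rle_lt_trans with (L * delta); [apply Rmult_le_compat_l; lra |].
  assert (delta * (2 * L) < m) by (apply (Rlt_div_r _ _ (2 * L)); [lra | exact HdL]).
  lra.
Qed.

Lemma RtoC_neq0 (r : R) : r <> 0 -> RtoC r <> 0%C.
Proof. intros H E; apply H; injection E; auto. Qed.

Ltac solve_RtoC_neq0 := repeat split; first [apply RtoC_neq0; lra | assumption].

Lemma Cmult_conj_r (c : C) : (c * Cconj c)%C = RtoC (Cmod c ^ 2).
Proof.
  rewrite Cmod2_alt; destruct c as [x y].
  unfold Cconj, Cmult, RtoC, Re, Im; cbn [fst snd]; f_equal; ring.
Qed.

Lemma Cmod_triangle_inv (x y : C) : Rabs (Cmod x - Cmod y) <= Cmod (x - y).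
Proof.
  assert (H1 : Cmod x <= Cmod (x - y) + Cmod y)
    by (replace x with ((x - y) + y)%C at 1 by ring; apply Cmod_triangle).
  assert (H2 : Cmod y <= Cmod (x - y) + Cmod x).
  { replace y with (- (x - y) + x)%C at 1 by ring.
    eapply Rle_trans; [apply Cmod_triangle |]; rewrite Cmod_opp; lra. }
  apply Rabs_le; lra.
Qed.

Lemma Rabs_fst_le_Cmod (z : C) : Rabs (fst z) <= Cmod z.
Proof. eapply Rle_trans; [apply Rmax_l | apply Rmax_Cmod]. Qed.

Lemma Rabs_snd_le_Cmod (z : C) : Rabs (snd z) <= Cmod z.
Proof. eapply Rle_trans; [apply Rmax_r | apply Rmax_Cmod]. Qed.

Lemma Cmod_le_Rabs_sum (z : C) : Cmod z <= Rabs (fst z) + Rabs (snd z).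
Proof.
  destruct z as [x y].
  assert (E : (x, y) = (RtoC x + Ci * RtoC y)%C)
    by (unfold Ci, RtoC, Cplus, Cmult; cbn [fst snd]; f_equal; ring).
  rewrite E at 1; eapply Rle_trans; [apply Cmod_triangle |].
  rewrite Cmod_mult, Cmod_Ci, !Cmod_R; cbn [fst snd]; lra.
Qed.

Lemma Cmod_pow_le_self (w : C) (n : nat) : Cmod w <= 1 -> (1 <= n)%nat -> Cmod w ^ n <= Cmod w.
Proof.
  intros Hw Hn; rewrite <- (pow_1 (Cmod w)) at 2.
  apply Rle_pow_le_1; [split; [apply Cmod_ge_0 | exact Hw] | exact Hn].
Qed.

Lemma Cexp_add (u v : C) : Cexp (u + v) = (Cexp u * Cexp v)%C.
Proof.
  destruct u as [x y], v as [x' y']; unfold Cexp, Cmult, Cplus; simpl.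
  rewrite exp_plus, cos_plus, sin_plus; f_equal; ring.
Qed.

Lemma Cmod_Cexp (u : C) : Cmod (Cexp u) = exp (Re u).
Proof.
  destruct u as [x y]; unfold Cexp, Cmod, Re, Im; cbn [fst snd].
  replace ((exp x * cos y) ^ 2 + (exp x * sin y) ^ 2) with (exp x ^ 2).
  - apply sqrt_pow2, Rlt_le, exp_pos.
  - pose proof (sin2_cos2 y) as Hsc; unfold Rsqr in Hsc; nra.
Qed.

Lemma Cexp_neq0 (u : C) : Cexp u <> 0%C.
Proof.
  intro E; pose proof (Cmod_Cexp u) as H; rewrite E, Cmod_0 in H.
  pose proof (exp_pos (Re u)); lra.
Qed.

Lemma Cmod_Cexp_le_1 (l : C) (tau : R) :
  0 <= Re l -> 0 <= tau -> Cmod (Cexp (- (l * RtoC tau))) <= 1.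
Proof.
  intros Hl Ht; rewrite Cmod_Cexp, <- exp_0.
  destruct l as [x y]; unfold Re, Cmult, Copp, RtoC in *; cbn [fst snd] in *.
  apply exp_le_compat; nra.
Qed.

Fixpoint exp_trunc (u : C) (n : nat) : C :=
  match n with
  | O => 1%C
  | S m => (exp_trunc u m + u ^ S m / RtoC (INR (fact (S m))))%C
  end.

Lemma exp_trunc_5 (u : C) : exp_trunc u 5 =
  (1 + u + u * u / RtoC 2 + u * u * u / RtoC 6 + u * u * u * u / RtoC 24
   + u * u * u * u * u / RtoC 120)%C.
Proof.
  cbn [exp_trunc]; simpl fact; simpl Cpow.
  rewrite !INR_IZR_INZ; cbn [Z.of_nat Pos.of_succ_nat Pos.succ].
  field; solve_RtoC_neq0.
Qed.

Definition re_Cexp_ray (c u : C) (t : R) : R := Re (c * Cexp (RtoC t * u)).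

Lemma re_Cexp_ray_derive (c u : C) (t : R) :
  is_derive (re_Cexp_ray c u) t (re_Cexp_ray (c * u) u t).
Proof.
  destruct c as [cr ci], u as [x y].
  unfold re_Cexp_ray, Cexp, Re, Im, Cmult, RtoC; cbn [fst snd].
  auto_derive; [exact I | unfold Rminus; ring].
Qed.

Lemma re_Cexp_ray_Derive_n (u : C) (n : nat) (c : C) (t : R) :
  Derive_n (re_Cexp_ray c u) n t = re_Cexp_ray (c * u ^ n) u t.
Proof.
  revert c t; induction n as [| n IH]; intros c t.
  - cbn [Derive_n Cpow]; rewrite Cmult_1_r; reflexivity.
  - simpl; rewrite (Derive_ext _ (re_Cexp_ray (c * u ^ n) u)) by (intro; apply IH).
    rewrite (is_derive_unique _ _ _ (re_Cexp_ray_derive _ _ _)).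
    unfold re_Cexp_ray; do 2 f_equal; ring.
Qed.

Lemma re_Cexp_ray_ex_derive_n (u c : C) (n : nat) (t : R) :
  ex_derive_n (re_Cexp_ray c u) n t.
Proof.
  destruct n as [| n]; [exact I |]; simpl.
  apply (ex_derive_ext (re_Cexp_ray (c * u ^ n) u)).
  - intro; symmetry; apply re_Cexp_ray_Derive_n.
  - eexists; apply re_Cexp_ray_derive.
Qed.

Lemma re_Cexp_ray_bound (c u : C) (t : R) :
  0 <= t <= 1 -> Rabs (re_Cexp_ray c u t) <= Cmod c * exp (Cmod u).
Proof.
  intros Ht; unfold re_Cexp_ray.
  eapply Rle_trans; [apply re_le_Cmod |].
  rewrite Cmod_mult, Cmod_Cexp.
  apply Rmult_le_compat_l; [apply Cmod_ge_0 | apply exp_le_compat].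
  pose proof (re_le_Cmod u) as Hu; apply Rabs_le_between in Hu.
  destruct u as [x y]; unfold Re, RtoC, Cmult in *; cbn [fst snd] in *; nra.
Qed.

Lemma Re_mul_exp_trunc (c u : C) (n : nat) :
  Re (c * exp_trunc u n) = sum_f_R0 (fun m => Re (c * u ^ m) / INR (fact m)) n.
Proof.
  induction n as [| n IH].
  - cbn [exp_trunc sum_f_R0 Cpow fact INR]; unfold Rdiv; rewrite Rinv_1, Rmult_1_r; reflexivity.
  - cbn [sum_f_R0 exp_trunc]; rewrite <- IH.
    assert (Hf : INR (fact (S n)) <> 0) by apply INR_fact_neq_0.
    set (f := INR (fact (S n))) in *; set (z := (u ^ S n)%C).
    destruct c as [cr ci], z as [zr zi], (exp_trunc u n) as [tr ti].
    unfold Re, Cmult, Cplus, Cdiv, Cinv, RtoC; cbn [fst snd]; unfold Cmult; cbn [fst snd].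
    field; exact Hf.
Qed.

Lemma re_Cexp_ray_0 (c u : C) : re_Cexp_ray c u 0 = Re c.
Proof.
  destruct c as [cr ci], u as [x y].
  unfold re_Cexp_ray, Cexp, Re, Im, Cmult, RtoC; cbn [fst snd].
  replace (0 * x - 0 * y) with 0 by ring; replace (0 * y + 0 * x) with 0 by ring.
  rewrite exp_0, cos_0, sin_0; ring.
Qed.

Lemma re_Cexp_ray_1 (c u : C) : re_Cexp_ray c u 1 = Re (c * Cexp u).
Proof. unfold re_Cexp_ray; rewrite Cmult_1_l; reflexivity. Qed.

Lemma Re_conj_mul (z : C) : Re (Cconj z * z) = Cmod z ^ 2.
Proof.
  rewrite Cmod2_alt; destruct z as [x y]; unfold Cconj, Re, Im, Cmult; cbn [fst snd]; ring.
Qed.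

(** Taylor's theorem for the complex exponential, obtained from the real
    Lagrange form applied to [t |-> Re (c e^(t u))] with [c] the conjugate of
    the error. *)
Lemma Cexp_taylor (u : C) (n : nat) :
  Cmod (Cexp u - exp_trunc u n) <= Cmod u ^ S n * exp (Cmod u).
Proof.
  set (err := (Cexp u - exp_trunc u n)%C).
  destruct (Taylor_Lagrange (re_Cexp_ray (Cconj err) u) n 0 1 Rlt_0_1)
    as [z [Hz HT]].
  { intros t _ k _; apply re_Cexp_ray_ex_derive_n. }
  rewrite Rminus_0_r, pow1, re_Cexp_ray_1, re_Cexp_ray_Derive_n in HT.
  assert (Hsum : sum_f_R0 (fun m => 1 ^ m / INR (fact m)
                   * Derive_n (re_Cexp_ray (Cconj err) u) m 0) n
                 = Re (Cconj err * exp_trunc u n)).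
  { rewrite Re_mul_exp_trunc; apply sum_eq; intros i _.
    rewrite re_Cexp_ray_Derive_n, re_Cexp_ray_0, pow1; field; apply INR_fact_neq_0. }
  assert (Hsq : Cmod err ^ 2
                = 1 / INR (fact (S n)) * re_Cexp_ray (Cconj err * u ^ S n) u z).
  { rewrite <- Re_conj_mul.
    replace (Cconj err * err)%C
      with (Cconj err * Cexp u - Cconj err * exp_trunc u n)%C by (unfold err; ring).
    transitivity (Re (Cconj err * Cexp u) - Re (Cconj err * exp_trunc u n));
      [reflexivity | rewrite <- Hsum; lra]. }
  assert (Hbound := re_Cexp_ray_bound (Cconj err * u ^ S n) u z
                      (conj (Rlt_le _ _ (proj1 Hz)) (Rlt_le _ _ (proj2 Hz)))).
  rewrite Cmod_mult, Cmod_conj, Cmod_pow in Hbound.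
  assert (Hfact : 1 <= INR (fact (S n))).
  { apply (le_INR 1); pose proof (lt_O_fact (S n)); lia. }
  assert (Hm : 0 <= Cmod err) by apply Cmod_ge_0.
  assert (HB : 0 <= Cmod u ^ S n * exp (Cmod u))
    by (apply Rmult_le_pos; [apply pow_le, Cmod_ge_0 | apply Rlt_le, exp_pos]).
  assert (Hsq' : Cmod err ^ 2 <= Cmod err * (Cmod u ^ S n * exp (Cmod u))).
  { rewrite Hsq; set (D := re_Cexp_ray _ u z) in *.
    apply Rle_trans with (Rabs D); [| lra].
    rewrite <- (Rabs_pos_eq (1 / _ * D)) by (rewrite <- Hsq; apply pow2_ge_0).
    rewrite Rabs_mult, Rabs_pos_eq by (apply Rlt_le, Rdiv_lt_0_compat; lra).
    rewrite <- (Rmult_1_l (Rabs D)) at 2; apply Rmult_le_compat_r; [apply Rabs_pos |].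
    apply Rle_trans with (1 / 1); [| lra].
    apply Rmult_le_compat_l; [lra | apply Rinv_le_contravar; lra]. }
  fold err; nra.
Qed.

Lemma Cexp_taylor_scaled (w : C) (tau : R) (n : nat) : Cmod w <= 1 ->
  Cmod (Cexp (- (w * RtoC tau)) - exp_trunc (- (w * RtoC tau)) n)
  <= Rabs tau ^ S n * exp (Rabs tau) * Cmod w ^ S n.
Proof.
  intro Hw; eapply Rle_trans; [apply Cexp_taylor |].
  rewrite Cmod_opp, Cmod_mult, Cmod_R, Rpow_mult_distr.
  assert (Hw0 := Cmod_ge_0 w); assert (Ht0 := Rabs_pos tau).
  replace (Rabs tau ^ S n * exp (Rabs tau) * Cmod w ^ S n)
    with (Cmod w ^ S n * Rabs tau ^ S n * exp (Rabs tau)) by ring.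
  apply Rmult_le_compat_l; [apply Rmult_le_pos; apply pow_le; lra |].
  apply exp_le_compat; nra.
Qed.

Lemma demoivre (phi : R) (n : nat) :
  ((cos phi, sin phi) ^ n)%C = (cos (INR n * phi), sin (INR n * phi)).
Proof.
  induction n as [| n IH].
  - simpl; rewrite Rmult_0_l, cos_0, sin_0; reflexivity.
  - cbn [Cpow]; rewrite IH, S_INR.
    replace ((INR n + 1) * phi) with (phi + INR n * phi) by ring.
    rewrite cos_plus, sin_plus; unfold Cmult; cbn [fst snd]; f_equal; ring.
Qed.

Lemma unit_polar (z : C) : Cmod z = 1 -> exists th, z = (cos th, sin th).
Proof.
  destruct z as [x y]; intro H; unfold Cmod in H; cbn [fst snd] in H.
  assert (Hxy : x ^ 2 + y ^ 2 = 1) by (rewrite <- (sqrt_sqrt (x ^ 2 + y ^ 2)), H by nra; ring).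
  assert (Hx : -1 <= x <= 1) by nra.
  assert (Hs : sqrt (1 - x²) = Rabs y)
    by (rewrite <- sqrt_Rsqr_abs; f_equal; unfold Rsqr; nra).
  destruct (Rle_dec 0 y) as [Hy | Hy].
  - exists (acos x); rewrite cos_acos, sin_acos, Hs, Rabs_pos_eq by auto; reflexivity.
  - exists (- acos x); rewrite cos_neg, sin_neg, cos_acos, sin_acos, Hs, Rabs_left by lra.
    f_equal; ring.
Qed.

Lemma unit_kth_root (z : C) (k : nat) :
  Cmod z = 1 -> (1 <= k)%nat -> exists u, Cmod u = 1 /\ (u ^ k)%C = z.
Proof.
  intros Hz Hk; destruct (unit_polar z Hz) as [th ->].
  exists (cos (th / INR k), sin (th / INR k)); split.
  - unfold Cmod; cbn [fst snd]; rewrite <- sqrt_1; f_equal.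
    rewrite <- (sin2_cos2 (th / INR k)); unfold Rsqr; ring.
  - rewrite demoivre; assert (INR k <> 0) by (apply not_0_INR; lia).
    replace (INR k * (th / INR k)) with th by (field; auto); reflexivity.
Qed.

(** * Minima of continuous functions on rectangles *)

Lemma inv_INR_S_lt (eps : R) : 0 < eps ->
  exists N : nat, forall n, (N <= n)%nat -> / (INR n + 1) < eps.
Proof.
  intro He; destruct (INR_unbounded (/ eps)) as [N HN]; exists N; intros n Hn.
  apply le_INR in Hn; pose proof (pos_INR N).
  assert (0 < / eps) by (apply Rinv_0_lt_compat; auto).
  rewrite <- (Rinv_inv eps); apply Rinv_lt_contravar; [apply Rmult_lt_0_compat |]; lra.
Qed.

Lemma inv_INR_S_pos (n : nat) : 0 < / (INR n + 1).
Proof. apply Rinv_0_lt_compat; pose proof (pos_INR n); lra. Qed.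

Definition cluster_point (xs : nat -> R) (l : R) : Prop :=
  forall eps N, 0 < eps -> exists p, (N <= p)%nat /\ Rabs (xs p - l) < eps.

Lemma bounded_seq_cluster_point (xs : nat -> R) (a b : R) :
  (forall n, a <= xs n <= b) -> exists l, a <= l <= b /\ cluster_point xs l.
Proof.
  intro Hb.
  destruct (Rtopology.Bolzano_Weierstrass xs (fun x => a <= x <= b)
              (Rtopology.compact_P3 a b) Hb) as [l Hl].
  assert (Hcl : cluster_point xs l).
  { intros eps N He; destruct (Hl (Rtopology.disc l (mkposreal eps He)) N) as [p [Hp Hd]].
    - exists (mkposreal eps He); intros y Hy; exact Hy.
    - exists p; split; auto. }
  exists l; split; [| exact Hcl].
  split; apply Rnot_lt_le; intro Hout.
  - destruct (Hcl (a - l) 0%nat ltac:(lra)) as [p [_ Hp]].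
    specialize (Hb p); apply Rabs_def2 in Hp; lra.
  - destruct (Hcl (l - b) 0%nat ltac:(lra)) as [p [_ Hp]].
    specialize (Hb p); apply Rabs_def2 in Hp; lra.
Qed.

(** Via a subsequence along which [xs] converges to its cluster point. *)
Lemma bounded_seq_cluster_point2 (xs ys : nat -> R) (a b c d : R) :
  (forall n, a <= xs n <= b) -> (forall n, c <= ys n <= d) ->
  exists lx ly, a <= lx <= b /\ c <= ly <= d /\
    forall eps N, 0 < eps ->
      exists p, (N <= p)%nat /\ Rabs (xs p - lx) < eps /\ Rabs (ys p - ly) < eps.
Proof.
  intros Hx Hy; destruct (bounded_seq_cluster_point xs a b Hx) as [lx [Hlx Cx]].
  assert (Hphi : forall k : nat, exists p, (k <= p)%nat /\ Rabs (xs p - lx) < / (INR k + 1))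
    by (intro k; apply Cx, inv_INR_S_pos).
  destruct (choice _ Hphi) as [phi Hphi2].
  destruct (bounded_seq_cluster_point (fun k => ys (phi k)) c d (fun k => Hy (phi k)))
    as [ly [Hly Cy]].
  exists lx, ly; split; [exact Hlx |]; split; [exact Hly |].
  intros eps N He; destruct (inv_INR_S_lt eps He) as [K HK].
  destruct (Cy eps (max N K) He) as [k [Hk Hyk]].
  destruct (Hphi2 k) as [H1 H2].
  exists (phi k); split; [lia |]; split; [| exact Hyk].
  eapply Rlt_trans; [exact H2 | apply HK; lia].
Qed.

Definition inbox (a b c d : R) (p : R * R) : Prop := a <= fst p <= b /\ c <= snd p <= d.

Definition continuous_on_box (f : R * R -> R) (a b c d : R) : Prop :=
  forall p, inbox a b c d p -> forall eps, 0 < eps -> exists delta, 0 < delta /\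
    forall q, inbox a b c d q -> Rabs (fst q - fst p) < delta ->
      Rabs (snd q - snd p) < delta -> Rabs (f q - f p) < eps.

Lemma box_minimizing_seq (f : R * R -> R) (a b c d : R) :
  a <= b -> c <= d -> (forall p, 0 <= f p) ->
  exists l, (forall q, inbox a b c d q -> l <= f q) /\
    forall n : nat, exists q, inbox a b c d q /\ f q < l + / (INR n + 1).
Proof.
  intros Hab Hcd Hpos.
  set (E := fun r => exists q, inbox a b c d q /\ r = - f q).
  assert (HE1 : bound E) by (exists 0; intros r [q [_ ->]]; specialize (Hpos q); lra).
  assert (HE2 : exists r, E r)
    by (exists (- f (a, c)), (a, c); split; [split; simpl; lra | reflexivity]).
  destruct (completeness E HE1 HE2) as [l [Hub Hlub]].
  exists (- l); split.
  - intros q Hq; assert (E (- f q)) as HEq by (exists q; auto); specialize (Hub _ HEq); lra.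
  - intro n; apply NNPP; intro Hn.
    assert (Hub' : is_upper_bound E (l - / (INR n + 1))).
    { intros r [q [Hq ->]]; apply Rnot_lt_le; intro Hlt.
      apply Hn; exists q; split; [exact Hq | lra]. }
    specialize (Hlub _ Hub'); pose proof (inv_INR_S_pos n); lra.
Qed.

Lemma continuous_on_box_min (f : R * R -> R) (a b c d : R) :
  a <= b -> c <= d -> continuous_on_box f a b c d -> (forall p, 0 <= f p) ->
  exists p, inbox a b c d p /\ forall q, inbox a b c d q -> f p <= f q.
Proof.
  intros Hab Hcd Hcont Hpos.
  destruct (box_minimizing_seq f a b c d Hab Hcd Hpos) as [l [Hl Hseq]].
  destruct (choice _ Hseq) as [sq Hsq].
  destruct (bounded_seq_cluster_point2 (fun n => fst (sq n)) (fun n => snd (sq n)) a b c d)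
    as [lx [ly [Hlx [Hly Hcl]]]]; [intro n; apply (Hsq n) .. |].
  exists (lx, ly); split; [split; auto |].
  intros q Hq; apply Rle_trans with l; [| apply Hl, Hq].
  apply Rnot_lt_le; intro Hgt; set (eps := (f (lx, ly) - l) / 2).
  assert (He : 0 < eps) by (unfold eps; lra).
  destruct (Hcont (lx, ly) (conj Hlx Hly) eps He) as [delta [Hd Hc]].
  destruct (inv_INR_S_lt eps He) as [N HN].
  destruct (Hcl delta N Hd) as [p [Hp [Hpx Hpy]]].
  specialize (Hc (sq p) (proj1 (Hsq p)) Hpx Hpy); apply Rabs_def2 in Hc.
  specialize (HN p Hp); destruct (Hsq p) as [_ Hfp]; unfold eps in *; lra.
Qed.

(** * Leading terms and the minimum modulus principle *)

Fixpoint cpoly_from (k : nat) (ds : list C) (w : C) : C :=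
  match ds with
  | nil => 0%C
  | d :: ds' => (d * w ^ k + cpoly_from (S k) ds' w)%C
  end.

Definition Cmod_sum (ds : list C) : R := fold_right (fun d s => Cmod d + s) 0 ds.

Lemma Cmod_sum_ge_0 (ds : list C) : 0 <= Cmod_sum ds.
Proof.
  induction ds as [| d ds IH]; simpl; [lra |]; pose proof (Cmod_ge_0 d); lra.
Qed.

Lemma Cmod_cpoly_from_le (ds : list C) (k : nat) (w : C) :
  Cmod w <= 1 -> Cmod (cpoly_from k ds w) <= Cmod_sum ds * Cmod w ^ k.
Proof.
  intros Hw; revert k; induction ds as [| d ds IH]; intro k; simpl.
  - rewrite Cmod_0; lra.
  - eapply Rle_trans; [apply Cmod_triangle |].
    rewrite Cmod_mult, Cmod_pow, Rmult_plus_distr_r.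
    apply Rplus_le_compat_l; eapply Rle_trans; [apply IH |].
    apply Rmult_le_compat_l; [apply Cmod_sum_ge_0 |].
    apply Rle_pow_le_1; [split; [apply Cmod_ge_0 | exact Hw] | lia].
Qed.

Lemma leading_term_of_expansion (G : C -> C) (ds : list C) (k : nat) (K0 : R) :
  0 <= K0 ->
  (forall w, Cmod w <= 1 ->
     Cmod (G w - cpoly_from k ds w) <= K0 * Cmod w ^ (k + List.length ds)) ->
  Exists (fun d : C => d <> 0%C) ds ->
  exists (j : nat) (c : C) (K : R), (k <= j)%nat /\ c <> 0%C /\ 0 <= K /\
    forall w, Cmod w <= 1 -> Cmod (G w - c * w ^ j) <= K * Cmod w ^ S j.
Proof.
  intros HK0; revert k; induction ds as [| d ds IH]; intros k HG Hnz;
    [inversion Hnz |].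
  destruct (classic (d = 0%C)) as [-> | Hd].
  - destruct (IH (S k)) as [j [c [K [Hj HjK]]]].
    + intros w Hw; specialize (HG w Hw); simpl in HG.
      rewrite Cmult_0_l, Cplus_0_l, <- plus_n_Sm in HG; exact HG.
    + inversion Hnz as [? ? Hz | ? ? Hex]; [contradiction | exact Hex].
    + exists j, c, K; split; [lia | exact HjK].
  - exists k, d, (K0 + Cmod_sum ds).
    split; [lia |]; split; [exact Hd |]; split; [pose proof (Cmod_sum_ge_0 ds); lra |].
    intros w Hw.
    replace (G w - d * w ^ k)%C
      with ((G w - cpoly_from k (d :: ds) w) + cpoly_from (S k) ds w)%C
      by (simpl; ring).
    eapply Rle_trans; [apply Cmod_triangle |].
    rewrite Rmult_plus_distr_r; apply Rplus_le_compat.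
    + eapply Rle_trans; [apply (HG w Hw) |].
      apply Rmult_le_compat_l; [exact HK0 |].
      apply Rle_pow_le_1; [split; [apply Cmod_ge_0 | exact Hw] | simpl; lia].
    + apply Cmod_cpoly_from_le, Hw.
Qed.

Definition has_leading_term (F : C -> C) (l0 : C) : Prop :=
  exists (k : nat) (c : C) (K : R), (1 <= k)%nat /\ c <> 0%C /\ 0 <= K /\
    forall w, Cmod w <= 1 -> Cmod (F (l0 + w)%C - F l0 - c * w ^ k) <= K * Cmod w ^ S k.

Lemma descent_direction (G c : C) (k : nat) : G <> 0%C -> c <> 0%C -> (1 <= k)%nat ->
  exists u, Cmod u = 1 /\
    forall t : R, (c * (RtoC t * u) ^ k)%C = (RtoC (- (Cmod c * t ^ k / Cmod G)) * G)%C.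
Proof.
  intros HG Hc Hk.
  assert (Hc0 : 0 < Cmod c) by (apply Cmod_gt_0; auto).
  assert (HG0 : 0 < Cmod G) by (apply Cmod_gt_0; auto).
  assert (HcG : RtoC (Cmod G * Cmod c) <> 0%C) by (apply RtoC_neq0; nra).
  set (z := (- G * Cconj c / RtoC (Cmod G * Cmod c))%C).
  assert (Hz : Cmod z = 1).
  { unfold z.
    rewrite Cmod_div, Cmod_mult, Cmod_opp, Cmod_conj, Cmod_R, Rabs_pos_eq by (auto || nra).
    field; nra. }
  destruct (unit_kth_root z k Hz Hk) as [u [Hu Huk]].
  exists u; split; [exact Hu |]; intro t.
  rewrite Cpow_mult_l, Huk, <- RtoC_pow; unfold z.
  replace (c * (RtoC (t ^ k) * (- G * Cconj c / RtoC (Cmod G * Cmod c))))%C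
    with (- (c * Cconj c) * RtoC (t ^ k) * G / RtoC (Cmod G * Cmod c))%C by (field; auto).
  rewrite Cmult_conj_r, RtoC_opp, RtoC_div, !RtoC_mult, !RtoC_pow by lra.
  field; solve_RtoC_neq0.
Qed.

Section LeadingTerm.
Variables (F : C -> C) (l0 : C).
Hypothesis HF : has_leading_term F l0.

Lemma leading_term_continuous (eps : R) : 0 < eps ->
  exists delta, 0 < delta /\ forall w, Cmod w < delta -> Cmod (F (l0 + w)%C - F l0) < eps.
Proof.
  intro He; destruct HF as [k [c [K [Hk [Hc [HK Hlead]]]]]].
  set (M := Cmod c + K + 1).
  assert (HM : 0 < M) by (unfold M; pose proof (Cmod_ge_0 c); lra).
  destruct (exists_pos_lt2 1 (eps / M) Rlt_0_1 (Rdiv_lt_0_compat _ _ He HM))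
    as [delta [Hd [Hd1 HdM]]].
  exists delta; split; [exact Hd |]; intros w Hw.
  assert (Hw0 := Cmod_ge_0 w).
  replace (F (l0 + w)%C - F l0)%C with ((F (l0 + w)%C - F l0 - c * w ^ k) + c * w ^ k)%C by ring.
  eapply Rle_lt_trans; [apply Cmod_triangle |]; rewrite Cmod_mult, Cmod_pow.
  pose proof (Hlead w ltac:(lra)) as Hb.
  pose proof (Cmod_pow_le_self w k ltac:(lra) Hk).
  pose proof (Cmod_pow_le_self w (S k) ltac:(lra) ltac:(lia)).
  pose proof (Cmod_ge_0 c); pose proof (pow_le _ k Hw0).
  assert (Cmod w * M < eps) by (apply (Rlt_div_r _ _ _ HM); lra).
  unfold M in *; nra.
Qed.

Lemma leading_term_isolated_zero : F l0 = 0%C ->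
  exists r, 0 < r /\ forall w, 0 < Cmod w < r -> F (l0 + w)%C <> 0%C.
Proof.
  intro H0; destruct HF as [k [c [K [Hk [Hc [HK Hlead]]]]]].
  assert (Hc0 : 0 < Cmod c) by (apply Cmod_gt_0; auto).
  destruct (exists_pos_lt2 1 (Cmod c / (K + 1)) Rlt_0_1 ltac:(apply Rdiv_lt_0_compat; lra))
    as [r [Hr [Hr1 HrK]]].
  exists r; split; [exact Hr |]; intros w [Hw0 Hw] E.
  specialize (Hlead w ltac:(lra)); rewrite E, H0 in Hlead.
  replace (0 - 0 - c * w ^ k)%C with (- (c * w ^ k))%C in Hlead by ring.
  rewrite Cmod_opp, Cmod_mult, Cmod_pow in Hlead; simpl pow in Hlead.
  assert (Hpk : 0 < Cmod w ^ k) by (apply pow_lt; auto).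
  assert (Cmod w * (K + 1) < Cmod c) by (apply (Rlt_div_r _ _ (K + 1)); lra).
  nra.
Qed.

(** The minimum modulus principle: step along a [k]-th root of [-F l0 / c]. *)
Lemma leading_term_descent (r : R) : F l0 <> 0%C -> 0 < r ->
  exists w, Cmod w < r /\ Cmod (F (l0 + w)%C) < Cmod (F l0).
Proof.
  intros HG Hr; destruct HF as [k [c [K [Hk [Hc [HK Hlead]]]]]].
  set (G := F l0) in *; clearbody G.
  assert (Hc0 : 0 < Cmod c) by (apply Cmod_gt_0; auto).
  assert (HG0 : 0 < Cmod G) by (apply Cmod_gt_0; auto).
  destruct (descent_direction G c k HG Hc Hk) as [u [Hu Hkey]].
  destruct (exists_pos_lt2 r 1 Hr Rlt_0_1) as [t1 [Ht1 [Ht1r Ht11]]].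
  destruct (exists_pos_lt2 (Cmod G / Cmod c) (Cmod c / (K + 1))
              ltac:(apply Rdiv_lt_0_compat; lra) ltac:(apply Rdiv_lt_0_compat; lra))
    as [t2 [Ht2 [Ht2G Ht2c]]].
  destruct (exists_pos_lt2 t1 t2 Ht1 Ht2) as [t [Ht [Htt1 Htt2]]].
  assert (Hw : Cmod (RtoC t * u)%C = t) by (rewrite Cmod_mult, Cmod_R, Hu, Rabs_pos_eq; lra).
  exists (RtoC t * u)%C; split; [lra |].
  specialize (Hlead (RtoC t * u)%C ltac:(lra)); rewrite Hw in Hlead.
  replace (F (l0 + RtoC t * u)%C)
    with ((F (l0 + RtoC t * u)%C - G - c * (RtoC t * u) ^ k)
          + RtoC (1 - Cmod c * t ^ k / Cmod G) * G)%C
    by (rewrite Hkey, RtoC_minus, RtoC_opp; ring).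
  eapply Rle_lt_trans; [apply Cmod_triangle |]; rewrite Cmod_mult, Cmod_R.
  assert (Hpk : 0 < t ^ k) by (apply pow_lt; lra).
  assert (Htk : t ^ k <= t) by (rewrite <- (pow_1 t) at 2; apply Rle_pow_le_1; [lra | exact Hk]).
  assert (Hct : t * Cmod c < Cmod G) by (apply (Rlt_div_r _ _ _ Hc0); lra).
  assert (HKt : t * (K + 1) < Cmod c) by (apply (Rlt_div_r _ _ (K + 1)); lra).
  assert (Hs : 0 <= Cmod c * t ^ k / Cmod G < 1).
  { split; [apply Rmult_le_pos; [nra | apply Rlt_le, Rinv_0_lt_compat, HG0] |].
    apply (Rmult_lt_reg_r (Cmod G)); [exact HG0 |].
    replace (Cmod c * t ^ k / Cmod G * Cmod G) with (Cmod c * t ^ k) by (field; lra); nra. }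
  rewrite Rabs_pos_eq by lra.
  replace ((1 - Cmod c * t ^ k / Cmod G) * Cmod G) with (Cmod G - Cmod c * t ^ k) by (field; lra).
  assert (K * t ^ S k < Cmod c * t ^ k) by (simpl pow; nra).
  lra.
Qed.
End LeadingTerm.

Section MinimumModulus.
Variable F : C -> C.
Hypothesis HF : forall l0, has_leading_term F l0.

Lemma Cmod_continuous_on_box (a b c d : R) : continuous_on_box (fun p => Cmod (F p)) a b c d.
Proof.
  intros p _ eps He.
  destruct (leading_term_continuous F p (HF p) eps He) as [delta [Hd H]].
  exists (delta / 2); split; [lra |]; intros q _ H1 H2.
  eapply Rle_lt_trans; [apply Cmod_triangle_inv |].
  replace q with (p + (q - p))%C at 1 by ring; apply H.
  eapply Rle_lt_trans; [apply Cmod_le_Rabs_sum |].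
  destruct q as [q1 q2], p as [p1 p2]; unfold Cminus, Cplus, Copp; cbn [fst snd] in *.
  unfold Rminus in H1, H2; lra.
Qed.

Lemma Cmod_min_on_box (a b c d : R) : a <= b -> c <= d ->
  exists p, inbox a b c d p /\ forall q, inbox a b c d q -> Cmod (F p) <= Cmod (F q).
Proof.
  intros Hab Hcd; apply (continuous_on_box_min (fun p => Cmod (F p)) a b c d Hab Hcd).
  - apply Cmod_continuous_on_box.
  - intro; apply Cmod_ge_0.
Qed.

Lemma interior_min_is_root (a b c d : R) (p : C) :
  a < fst p < b -> c < snd p < d ->
  (forall q, inbox a b c d q -> Cmod (F p) <= Cmod (F q)) -> F p = 0%C.
Proof.
  intros Hx Hy Hmin; apply NNPP; intro Hnz.
  set (rho := Rmin (Rmin (fst p - a) (b - fst p)) (Rmin (snd p - c) (d - snd p))).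
  assert (Hrho : 0 < rho) by (unfold rho; repeat apply Rmin_pos; lra).
  destruct (leading_term_descent F p (HF p) rho Hnz Hrho) as [w [Hw Hlt]].
  assert (Hin : inbox a b c d (p + w)%C).
  { pose proof (Rabs_fst_le_Cmod w) as Hw1; pose proof (Rabs_snd_le_Cmod w) as Hw2.
    apply Rabs_le_between in Hw1; apply Rabs_le_between in Hw2.
    assert (rho <= fst p - a /\ rho <= b - fst p /\ rho <= snd p - c /\ rho <= d - snd p).
    { unfold rho; repeat split.
      - eapply Rle_trans; apply Rmin_l.
      - eapply Rle_trans; [apply Rmin_l | apply Rmin_r].
      - eapply Rle_trans; [apply Rmin_r | apply Rmin_l].
      - eapply Rle_trans; apply Rmin_r. }
    destruct p as [p1 p2], w as [w1 w2]; unfold inbox, Cplus; cbn [fst snd] in *.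
    split; split; lra. }
  specialize (Hmin _ Hin); lra.
Qed.

Lemma Cmod_lower_bound_on_box (a b c d : R) : a <= b -> c <= d ->
  (forall q, inbox a b c d q -> F q <> 0%C) ->
  exists m, 0 < m /\ forall q, inbox a b c d q -> m <= Cmod (F q).
Proof.
  intros Hab Hcd Hnz; destruct (Cmod_min_on_box a b c d Hab Hcd) as [p [Hp Hm]].
  exists (Cmod (F p)); split; [apply Cmod_gt_0, Hnz, Hp | exact Hm].
Qed.

Definition on_square_boundary (x y r : R) (q : C) : Prop :=
  inbox (x - r) (x + r) (y - r) (y + r) q /\
  (fst q = x - r \/ fst q = x + r \/ snd q = y - r \/ snd q = y + r).

Lemma Cmod_lower_bound_on_square_boundary (x y r : R) : 0 < r ->
  (forall q, on_square_boundary x y r q -> F q <> 0%C) ->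
  exists m, 0 < m /\ forall q, on_square_boundary x y r q -> m <= Cmod (F q).
Proof.
  intros Hr Hnz.
  assert (Hside : forall a b c d, a <= b -> c <= d ->
            (forall q, inbox a b c d q -> on_square_boundary x y r q) ->
            exists m, 0 < m /\ forall q, inbox a b c d q -> m <= Cmod (F q)).
  { intros a b c d Hab Hcd Hsub; apply Cmod_lower_bound_on_box; auto. }
  destruct (Hside (x - r) (x - r) (y - r) (y + r)) as [m1 [Hm1 H1]]; try lra.
  { intros q [Hq1 Hq2]; split; [split; lra | left; lra]. }
  destruct (Hside (x + r) (x + r) (y - r) (y + r)) as [m2 [Hm2 H2]]; try lra.
  { intros q [Hq1 Hq2]; split; [split; lra | right; left; lra]. }
  destruct (Hside (x - r) (x + r) (y - r) (y - r)) as [m3 [Hm3 H3]]; try lra.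
  { intros q [Hq1 Hq2]; split; [split; lra | right; right; left; lra]. }
  destruct (Hside (x - r) (x + r) (y + r) (y + r)) as [m4 [Hm4 H4]]; try lra.
  { intros q [Hq1 Hq2]; split; [split; lra | right; right; right; lra]. }
  exists (Rmin (Rmin m1 m2) (Rmin m3 m4)); split; [repeat apply Rmin_pos; lra |].
  intros q [[Hqx Hqy] Hb].
  pose proof (Rmin_l (Rmin m1 m2) (Rmin m3 m4)); pose proof (Rmin_r (Rmin m1 m2) (Rmin m3 m4)).
  pose proof (Rmin_l m1 m2); pose proof (Rmin_r m1 m2).
  pose proof (Rmin_l m3 m4); pose proof (Rmin_r m3 m4).
  destruct Hb as [E | [E | [E | E]]].
  - specialize (H1 q ltac:(split; lra)); lra.
  - specialize (H2 q ltac:(split; lra)); lra.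
  - specialize (H3 q ltac:(split; lra)); lra.
  - specialize (H4 q ltac:(split; lra)); lra.
Qed.
End MinimumModulus.

(** A Rouche-type argument based on the minimum modulus principle. *)
Lemma zero_of_small_perturbation (F G : C -> C) (x y r m : R) :
  (forall l0, has_leading_term G l0) -> 0 < r ->
  F (x, y) = 0%C ->
  (forall q, on_square_boundary x y r q -> m <= Cmod (F q)) ->
  (forall q, inbox (x - r) (x + r) (y - r) (y + r) q -> Cmod (G q - F q) < m / 2) ->
  exists p, inbox (x - r) (x + r) (y - r) (y + r) p /\ G p = 0%C.
Proof.
  intros HG Hr H0 Hbd Hclose.
  destruct (Cmod_min_on_box G HG (x - r) (x + r) (y - r) (y + r)) as [p [Hp Hmin]]; try lra.
  assert (Hc : inbox (x - r) (x + r) (y - r) (y + r) (x, y)) by (split; cbn [fst snd]; lra).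
  assert (Hsmall : Cmod (G p) < m / 2).
  { eapply Rle_lt_trans; [apply Hmin, Hc |].
    specialize (Hclose _ Hc); rewrite H0 in Hclose.
    replace (G (x, y) - 0)%C with (G (x, y)) in Hclose by ring; exact Hclose. }
  exists p; split; [exact Hp |].
  destruct Hp as [[Hp1 Hp2] [Hp3 Hp4]].
  apply (interior_min_is_root G HG (x - r) (x + r) (y - r) (y + r)); [split | split | exact Hmin].
  all: apply Rnot_le_lt; intro Hedge.
  all: assert (Hb : on_square_boundary x y r p) by (split; [split; split; lra | lra]).
  all: specialize (Hbd p Hb); specialize (Hclose p (conj (conj Hp1 Hp2) (conj Hp3 Hp4))).
  all: pose proof (Cmod_triangle_inv (F p) (G p)) as Htri; apply Rabs_le_between in Htri.
  all: replace (F p - G p)%C with (- (G p - F p))%C in Htri by ring; rewrite Cmod_opp in Htri.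
  all: lra.
Qed.

(** In [(q + b w) e^(-t w)] the coefficient of [w^n] is
    [(-t)^(n-1) (n b - q t) / n!]; two consecutive ones can only vanish
    together when [t = 0] or [b = q t = 0]. *)
Lemma exp_lin_coeff_3_eq0 (q b t : C) :
  (q * t * t * t * t / RtoC 24 - b * t * t * t / RtoC 6)%C = 0%C ->
  (- q * t * t * t * t * t / RtoC 120 + b * t * t * t * t / RtoC 24)%C = 0%C ->
  (- q * t * t * t / RtoC 6 + b * t * t / RtoC 2)%C = 0%C.
Proof.
  intros H4 H5; destruct (classic (t = 0%C)) as [-> | Ht].
  - field; solve_RtoC_neq0.
  - assert (E4 : (q * t - RtoC 4 * b)%C = 0%C).
    { replace (q * t - RtoC 4 * b)%C with (RtoC 24 * (q * t * t * t * t / RtoC 24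
        - b * t * t * t / RtoC 6) / (t * t * t))%C by (field; solve_RtoC_neq0).
      rewrite H4; field; solve_RtoC_neq0. }
    assert (E5 : (q * t - RtoC 5 * b)%C = 0%C).
    { replace (q * t - RtoC 5 * b)%C with (- RtoC 120 * (- q * t * t * t * t * t / RtoC 120
        + b * t * t * t * t / RtoC 24) / (t * t * t * t))%C by (field; solve_RtoC_neq0).
      rewrite H5; field; solve_RtoC_neq0. }
    replace (- q * t * t * t / RtoC 6 + b * t * t / RtoC 2)%C
      with (t * t * ((q * t - RtoC 5 * b) - RtoC 2 * (q * t - RtoC 4 * b)) / RtoC 6)%C
      by (field; solve_RtoC_neq0).
    rewrite E4, E5; field; solve_RtoC_neq0.
Qed.

Section CharfExpansion.
Variables (a2 a1 a0 b1 b0 tau : R) (l0 : C).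
Local Notation g := (charf a2 a1 a0 b1 b0 tau).
Local Notation t := (RtoC tau).
Local Notation E0 := (Cexp (- (l0 * RtoC tau))).
Local Notation q0 := (RtoC b1 * l0 + RtoC b0)%C.

(** The coefficients of [w, ..., w^5] in [g (l0 + w) - g l0], the delay term
    being [E0 (q0 + b1 w) e^(-tau w)]. *)
Definition charf_taylor_coeffs : list C :=
  [ (3 * l0 * l0 + 2 * RtoC a2 * l0 + RtoC a1 + E0 * (RtoC b1 - t * q0))%C;
    (3 * l0 + RtoC a2 + E0 * (q0 * t * t / RtoC 2 - RtoC b1 * t))%C;
    (1 + E0 * (- q0 * t * t * t / RtoC 6 + RtoC b1 * t * t / RtoC 2))%C;
    (E0 * (q0 * t * t * t * t / RtoC 24 - RtoC b1 * t * t * t / RtoC 6))%C;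
    (E0 * (- q0 * t * t * t * t * t / RtoC 120 + RtoC b1 * t * t * t * t / RtoC 24))%C ].

Lemma charf_shift (w : C) :
  (g (l0 + w) - g l0)%C =
  (cpoly_from 1 charf_taylor_coeffs w
   + E0 * (- RtoC b1 * t * t * t * t * t / RtoC 120) * w ^ 6
   + (q0 + RtoC b1 * w) * E0 * (Cexp (- (w * t)) - exp_trunc (- (w * t)) 5))%C.
Proof.
  unfold charf.
  replace (Cexp (- ((l0 + w) * t))) with (E0 * Cexp (- (w * t)))%C
    by (rewrite <- Cexp_add; f_equal; ring).
  rewrite exp_trunc_5; simpl; field; solve_RtoC_neq0.
Qed.

Lemma charf_taylor_coeffs_nonzero : Exists (fun d : C => d <> 0%C) charf_taylor_coeffs.
Proof.
  unfold charf_taylor_coeffs; do 2 apply Exists_cons_tl.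
  destruct (classic (E0 * (q0 * t * t * t * t / RtoC 24 - RtoC b1 * t * t * t / RtoC 6) = 0)%C)
    as [H4 | H4]; [| apply Exists_cons_tl, Exists_cons_hd; exact H4].
  destruct (classic (E0 * (- q0 * t * t * t * t * t / RtoC 120 + RtoC b1 * t * t * t * t / RtoC 24) = 0)%C)
    as [H5 | H5]; [| do 2 apply Exists_cons_tl; apply Exists_cons_hd; exact H5].
  apply Exists_cons_hd; intro H3.
  assert (Hcancel : forall z : C, (E0 * z)%C = 0%C -> z = 0%C).
  { intros z Hz; apply NNPP; intro Hnz; exact (Cmult_neq_0 _ _ (Cexp_neq0 _) Hnz Hz). }
  rewrite (exp_lin_coeff_3_eq0 _ _ _ (Hcancel _ H4) (Hcancel _ H5)), Cmult_0_r, Cplus_0_r in H3.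
  exact (RtoC_neq0 1 R1_neq_R0 H3).
Qed.

Lemma charf_has_leading_term : has_leading_term g l0.
Proof.
  set (K0 := (Cmod q0 + Rabs b1) * Cmod E0 * (Rabs tau ^ 6 * exp (Rabs tau))
             + Cmod (E0 * (- RtoC b1 * t * t * t * t * t / RtoC 120))).
  assert (HK0 : 0 <= K0).
  { pose proof (Cmod_ge_0 q0); pose proof (Rabs_pos b1); pose proof (Cmod_ge_0 E0).
    pose proof (Cmod_ge_0 (E0 * (- RtoC b1 * t * t * t * t * t / RtoC 120))).
    pose proof (exp_pos (Rabs tau)); pose proof (pow_le _ 6 (Rabs_pos tau)).
    unfold K0; apply Rplus_le_le_0_compat; [| assumption].
    apply Rmult_le_pos; [apply Rmult_le_pos |]; nra. }
  destruct (leading_term_of_expansion (fun w => g (l0 + w) - g l0)%C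
              charf_taylor_coeffs 1 K0 HK0) as [k [c [K [Hk [Hc [HK Hb]]]]]].
  - intros w Hw; rewrite charf_shift; simpl (1 + _)%nat.
    set (P := cpoly_from 1 charf_taylor_coeffs w).
    set (d6 := (E0 * (- RtoC b1 * t * t * t * t * t / RtoC 120))%C).
    set (Rm := (Cexp (- (w * t)) - exp_trunc (- (w * t)) 5)%C).
    replace (P + d6 * w ^ 6 + (q0 + RtoC b1 * w) * E0 * Rm - P)%C
      with (d6 * w ^ 6 + (q0 + RtoC b1 * w) * E0 * Rm)%C by ring.
    assert (Hw0 := Cmod_ge_0 w).
    assert (Hq : Cmod (q0 + RtoC b1 * w) <= Cmod q0 + Rabs b1).
    { eapply Rle_trans; [apply Cmod_triangle |]; rewrite Cmod_mult, Cmod_R.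
      pose proof (Rabs_pos b1); nra. }
    pose proof (Cexp_taylor_scaled w tau 5 Hw) as HRm; fold Rm in HRm.
    eapply Rle_trans; [apply Cmod_triangle |].
    rewrite Cmod_mult, Cmod_pow, (Cmod_mult _ Rm), (Cmod_mult _ E0); unfold K0; fold d6.
    pose proof (Cmod_ge_0 E0); pose proof (Cmod_ge_0 q0); pose proof (Cmod_ge_0 Rm).
    pose proof (pow_le _ 6 Hw0); pose proof (Cmod_ge_0 (q0 + RtoC b1 * w)).
    assert (Cmod (q0 + RtoC b1 * w) * Cmod E0 * Cmod Rm
            <= (Cmod q0 + Rabs b1) * Cmod E0 * (Rabs tau ^ 6 * exp (Rabs tau) * Cmod w ^ 6)).
    { apply Rmult_le_compat; [apply Rmult_le_pos; lra | lra | | exact HRm].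
      apply Rmult_le_compat_r; lra. }
    lra.
  - apply charf_taylor_coeffs_nonzero.
  - exists k, c, K; split; [exact Hk |]; split; [exact Hc |]; split; [exact HK |].
    exact Hb.
Qed.
End CharfExpansion.

(** * Continuity of the roots in the delay *)

Section CharfStability.
Variables a2 a1 a0 b1 b0 : R.
Local Notation g := (charf a2 a1 a0 b1 b0).

Definition coeff_bound : R := 1 + Rabs a2 + Rabs a1 + Rabs a0 + Rabs b1 + Rabs b0.

Lemma coeff_bound_ge_0 : 0 <= coeff_bound.
Proof.
  unfold coeff_bound; pose proof (Rabs_pos a2); pose proof (Rabs_pos a1);
    pose proof (Rabs_pos a0); pose proof (Rabs_pos b1); pose proof (Rabs_pos b0); lra.
Qed.

(** Roots in the closed right half-plane satisfy [|e^(-l tau)| <= 1], so they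
    obey the Cauchy bound of a cubic. *)
Lemma charf_root_bound (tau : R) (l : C) :
  0 <= tau -> 0 <= Re l -> g tau l = 0%C -> Cmod l <= coeff_bound.
Proof.
  intros Ht Hl H; unfold charf in H.
  set (E := Cexp (- (l * RtoC tau))) in *.
  assert (HE : Cmod E <= 1) by (apply Cmod_Cexp_le_1; auto); clearbody E.
  assert (Hl3 : (l * l * l)%C = (- (RtoC a2 * (l * l) + RtoC a1 * l + RtoC a0
                                    + (RtoC b1 * l + RtoC b0) * E))%C).
  { rewrite <- (Cplus_0_l (- _)), <- H; ring. }
  set (r := Cmod l); assert (Hr0 : 0 <= r) by apply Cmod_ge_0.
  assert (Hc : r * r * r <= Rabs a2 * (r * r) + Rabs a1 * r + Rabs a0 + (Rabs b1 * r + Rabs b0)).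
  { replace (r * r * r) with (Cmod (l * l * l)) by (unfold r; rewrite !Cmod_mult; ring).
    rewrite Hl3, Cmod_opp.
    repeat (eapply Rle_trans; [apply Cmod_triangle |]; apply Rplus_le_compat;
            try apply Rle_refl).
    all: try (rewrite ?Cmod_mult, ?Cmod_R; unfold r; right; ring).
    rewrite Cmod_mult; apply Rle_trans with (Cmod (RtoC b1 * l + RtoC b0) * 1).
    - apply Rmult_le_compat_l; [apply Cmod_ge_0 | exact HE].
    - rewrite Rmult_1_r; eapply Rle_trans; [apply Cmod_triangle |].
      rewrite !Cmod_mult, !Cmod_R; right; unfold r; ring. }
  unfold coeff_bound; pose proof (Rabs_pos a2); pose proof (Rabs_pos a1);
    pose proof (Rabs_pos a0); pose proof (Rabs_pos b1); pose proof (Rabs_pos b0).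
  destruct (Rle_dec r 1); [lra |].
  assert (r * r * r <= (Rabs a2 + Rabs a1 + Rabs a0 + Rabs b1 + Rabs b0) * (r * r)).
  { assert (Hrr : r <= r * r) by nra; assert (H1r : 1 <= r * r) by nra.
    pose proof (Rmult_le_compat_l _ _ _ (Rabs_pos a1) Hrr).
    pose proof (Rmult_le_compat_l _ _ _ (Rabs_pos b1) Hrr).
    pose proof (Rmult_le_compat_l _ _ _ (Rabs_pos a0) H1r).
    pose proof (Rmult_le_compat_l _ _ _ (Rabs_pos b0) H1r); nra. }
  nra.
Qed.

Definition tau_lipschitz_const (M : R) : R := (Rabs b1 * M + Rabs b0) * M * exp M + 1.

Lemma tau_lipschitz_const_pos (M : R) : 0 <= M -> 0 < tau_lipschitz_const M.
Proof.
  intro HM; unfold tau_lipschitz_const.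
  pose proof (Rabs_pos b1); pose proof (Rabs_pos b0); pose proof (exp_pos M).
  assert (0 <= (Rabs b1 * M + Rabs b0) * M * exp M)
    by (apply Rmult_le_pos; [apply Rmult_le_pos |]; nra).
  lra.
Qed.

Lemma charf_tau_lipschitz (M tau tau' : R) (l : C) :
  0 <= M -> Cmod l <= M -> 0 <= Re l -> 0 <= tau -> 0 <= tau' -> Rabs (tau - tau') <= 1 ->
  Cmod (g tau l - g tau' l) <= tau_lipschitz_const M * Rabs (tau - tau').
Proof.
  intros HM Hl Hre Ht Ht' Hd; unfold charf.
  set (D := Rabs (tau - tau')) in Hd |- *; set (u := (- (l * RtoC (tau - tau')))%C).
  replace (Cexp (- (l * RtoC tau))) with (Cexp (- (l * RtoC tau')) * Cexp u)%C
    by (rewrite <- Cexp_add; f_equal; unfold u; rewrite RtoC_minus; ring).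
  replace (_ - _)%C
    with ((RtoC b1 * l + RtoC b0) * Cexp (- (l * RtoC tau')) * (Cexp u - exp_trunc u 0))%C
    by (cbn [exp_trunc]; ring).
  rewrite !Cmod_mult.
  assert (HD : 0 <= D) by apply Rabs_pos; assert (Hl0 := Cmod_ge_0 l).
  assert (Hu : Cmod u = Cmod l * D)
    by (unfold u, D; rewrite Cmod_opp, Cmod_mult, Cmod_R; reflexivity).
  assert (HT : Cmod (Cexp u - exp_trunc u 0) <= M * exp M * D).
  { eapply Rle_trans; [apply Cexp_taylor |]; rewrite pow_1, Hu.
    pose proof (exp_pos (Cmod l * D)); pose proof (exp_pos M).
    assert (exp (Cmod l * D) <= exp M) by (apply exp_le_compat; nra).
    apply Rle_trans with (M * D * exp M); [apply Rmult_le_compat; nra | right; ring]. }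
  assert (HQ : Cmod (RtoC b1 * l + RtoC b0) <= Rabs b1 * M + Rabs b0).
  { eapply Rle_trans; [apply Cmod_triangle |]; rewrite Cmod_mult, !Cmod_R.
    pose proof (Rabs_pos b1); nra. }
  pose proof (Cmod_Cexp_le_1 l tau' Hre Ht').
  pose proof (Cmod_ge_0 (RtoC b1 * l + RtoC b0)); pose proof (Cmod_ge_0 (Cexp (- (l * RtoC tau')))).
  pose proof (Cmod_ge_0 (Cexp u - exp_trunc u 0)).
  apply Rle_trans with ((Rabs b1 * M + Rabs b0) * 1 * (M * exp M * D)).
  - apply Rmult_le_compat; [apply Rmult_le_pos; lra | lra | | lra].
    apply Rmult_le_compat; lra.
  - unfold tau_lipschitz_const; pose proof (exp_pos M); pose proof (Rabs_pos b1);
      pose proof (Rabs_pos b0).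
    assert (0 <= (Rabs b1 * M + Rabs b0) * M * exp M)
      by (apply Rmult_le_pos; [apply Rmult_le_pos |]; nra).
    nra.
Qed.

(** Roots in the closed right half-plane stay in a fixed compact box, on which
    [|g t|] has a positive minimum. *)
Lemma all_roots_neg_open (t : R) : 0 <= t -> all_roots_neg a2 a1 a0 b1 b0 t ->
  exists delta, 0 < delta /\ forall tau, 0 <= tau -> Rabs (tau - t) < delta ->
    all_roots_neg a2 a1 a0 b1 b0 tau.
Proof.
  intros Ht Hst; set (Mb := coeff_bound).
  assert (HM : 0 <= Mb) by apply coeff_bound_ge_0.
  assert (Hnz : forall q, inbox 0 Mb (- Mb) Mb q -> g t q <> 0%C)
    by (intros q [[Hq _] _] Hq0; specialize (Hst q Hq0); exact (Rlt_not_le _ _ Hst Hq)).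
  destruct (Cmod_lower_bound_on_box (g t) (charf_has_leading_term a2 a1 a0 b1 b0 t) 0 Mb (- Mb) Mb
              ltac:(lra) ltac:(lra) Hnz) as [m [Hm Hmin]].
  destruct (exists_pos_small_delta _ m (tau_lipschitz_const_pos Mb HM) Hm)
    as [delta [Hd Hsmall]].
  exists delta; split; [exact Hd |]; intros tau Htau Hdt l Hl.
  apply Rnot_le_lt; intro Hre.
  assert (HlM : Cmod l <= Mb) by exact (charf_root_bound tau l Htau Hre Hl).
  assert (Hin : inbox 0 Mb (- Mb) Mb l).
  { pose proof (Rabs_fst_le_Cmod l) as H1; pose proof (Rabs_snd_le_Cmod l) as H2.
    apply Rabs_le_between in H1; apply Rabs_le_between in H2.
    unfold Re in Hre; split; split; lra. }
  rewrite Rabs_minus_sym in Hdt; destruct (Hsmall _ (conj (Rabs_pos _) Hdt)) as [Hd1 HL].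
  pose proof (charf_tau_lipschitz Mb t tau l HM HlM Hre Ht Htau Hd1) as HP.
  rewrite Hl in HP; replace (g t l - 0)%C with (g t l) in HP by ring.
  specialize (Hmin l Hin); lra.
Qed.

Lemma unstable_root_persists (t : R) (l0 : C) : 0 <= t -> g t l0 = 0%C -> 0 < Re l0 ->
  exists delta, 0 < delta /\ forall tau, 0 <= tau -> Rabs (tau - t) < delta ->
    exists l, g tau l = 0%C /\ 0 < Re l.
Proof.
  intros Ht H0 Hre.
  destruct (leading_term_isolated_zero (g t) l0 (charf_has_leading_term a2 a1 a0 b1 b0 t l0) H0)
    as [r0 [Hr0 Hiso]].
  destruct l0 as [x y]; unfold Re in Hre; cbn [fst] in Hre.
  destruct (exists_pos_lt2 (r0 / 4) (x / 2) ltac:(lra) ltac:(lra)) as [r [Hr [Hr1 Hr2]]].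
  assert (Hnear : forall q, inbox (x - r) (x + r) (y - r) (y + r) q ->
                   Cmod (q - (x, y)) <= 2 * r).
  { intros q [Hq1 Hq2]; eapply Rle_trans; [apply Cmod_le_Rabs_sum |].
    destruct q as [q1 q2]; unfold Cminus, Cplus, Copp; cbn [fst snd] in *.
    assert (Rabs (q1 + - x) <= r) by (apply Rabs_le; lra).
    assert (Rabs (q2 + - y) <= r) by (apply Rabs_le; lra); lra. }
  destruct (Cmod_lower_bound_on_square_boundary
              (g t) (charf_has_leading_term a2 a1 a0 b1 b0 t) x y r Hr)
    as [m [Hm Hbd]].
  { intros q [Hq Hb]; replace q with ((x, y) + (q - (x, y)))%C by ring; apply Hiso.
    split; [| specialize (Hnear q Hq); lra].
    destruct q as [q1 q2]; unfold Cminus, Cplus, Copp; cbn [fst snd] in *.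
    pose proof (Rabs_fst_le_Cmod (q1 + - x, q2 + - y)) as H1.
    pose proof (Rabs_snd_le_Cmod (q1 + - x, q2 + - y)) as H2; cbn [fst snd] in H1, H2.
    destruct Hb as [E | [E | [E | E]]]; subst;
      [rewrite Rabs_left in H1 | rewrite Rabs_pos_eq in H1 | rewrite Rabs_left in H2
      | rewrite Rabs_pos_eq in H2]; lra. }
  set (M := Cmod (x, y) + 2 * r).
  assert (HM : 0 <= M) by (unfold M; pose proof (Cmod_ge_0 (x, y)); lra).
  destruct (exists_pos_small_delta _ m (tau_lipschitz_const_pos M HM) Hm)
    as [delta [Hd Hsmall]].
  exists delta; split; [exact Hd |]; intros tau Htau Hdt.
  destruct (Hsmall _ (conj (Rabs_pos _) Hdt)) as [Hd1 HL].
  destruct (zero_of_small_perturbation (g t) (g tau) x y r m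
              (charf_has_leading_term a2 a1 a0 b1 b0 tau) Hr H0 Hbd) as [p [Hp Hgp]].
  - intros q Hq; eapply Rle_lt_trans; [| exact HL]; apply charf_tau_lipschitz; auto.
    + replace q with ((x, y) + (q - (x, y)))%C by ring.
      eapply Rle_trans; [apply Cmod_triangle |]; specialize (Hnear q Hq); unfold M; lra.
    + destruct Hq as [Hq _]; unfold Re; lra.
  - exists p; split; [exact Hgp |]; destruct Hp as [Hp _]; unfold Re; lra.
Qed.
End CharfStability.

Lemma inf_of_nonneg_set (U : R -> Prop) (tau1 : R) :
  U tau1 -> (forall tau, U tau -> 0 <= tau) ->
  exists t, 0 <= t <= tau1 /\ (forall tau, U tau -> t <= tau) /\
    forall eps, 0 < eps -> exists tau, U tau /\ tau < t + eps.
Proof.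
  intros H1 Hpos; set (E := fun x => exists tau, U tau /\ x = - tau).
  assert (HE1 : bound E) by (exists 0; intros x [tau [Hu ->]]; specialize (Hpos _ Hu); lra).
  assert (HE2 : exists x, E x) by (exists (- tau1), tau1; split; [exact H1 | reflexivity]).
  destruct (completeness E HE1 HE2) as [l [Hub Hlub]].
  assert (Hlow : forall tau, U tau -> - l <= tau).
  { intros tau Hu; assert (HEt : E (- tau)) by (exists tau; auto); specialize (Hub _ HEt); lra. }
  exists (- l); split; [split; [| apply Hlow, H1] |]; [| split; [exact Hlow |]].
  - assert (Hub0 : is_upper_bound E 0) by (intros x [tau [Hu ->]]; specialize (Hpos _ Hu); lra).
    specialize (Hlub _ Hub0); lra.
  - intros eps He; apply NNPP; intro Hn.
    assert (Hub' : is_upper_bound E (l - eps)).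
    { intros x [tau [Hu ->]]; apply Rnot_lt_le; intro Hlt.
      apply Hn; exists tau; split; [exact Hu | lra]. }
    specialize (Hlub _ Hub'); lra.
Qed.

(** At the infimum [t] of the unstable delays, stability would extend to a
    neighbourhood of [t], and a root with positive real part would persist
    below [t]; a root on the imaginary axis is excluded by hypothesis. *)
Lemma all_roots_neg_until_crossing (a2 a1 a0 b1 b0 T : R) :
  all_roots_neg a2 a1 a0 b1 b0 0 ->
  (forall tau, 0 <= tau < T -> forall l, Re l = 0 -> charf a2 a1 a0 b1 b0 tau l <> 0%C) ->
  forall tau, 0 <= tau < T -> all_roots_neg a2 a1 a0 b1 b0 tau.
Proof.
  intros H0 Hax tau1 Htau1; apply NNPP; intro Hns.
  destruct (inf_of_nonneg_set
              (fun tau => 0 <= tau < T /\ ~ all_roots_neg a2 a1 a0 b1 b0 tau) tau1)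
    as [t [Ht [Hlow Happrox]]]; [split; auto | intros tau [[Hta _] _]; exact Hta |].
  destruct (classic (all_roots_neg a2 a1 a0 b1 b0 t)) as [Hst | Hst].
  - destruct (all_roots_neg_open a2 a1 a0 b1 b0 t (proj1 Ht) Hst) as [d [Hd Hop]].
    destruct (Happrox d Hd) as [tau [[Htau Hun] Hlt]].
    specialize (Hlow tau (conj Htau Hun)).
    apply Hun, Hop; [lra | rewrite Rabs_pos_eq; lra].
  - assert (Hroot : exists l0, charf a2 a1 a0 b1 b0 t l0 = 0%C /\ 0 < Re l0).
    { apply NNPP; intro Hn; apply Hst; intros l0 Hl0; apply Rnot_le_lt; intro Hle.
      destruct (Rle_lt_or_eq_dec _ _ Hle) as [Hlt | Heq].
      - apply Hn; exists l0; auto.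
      - apply (Hax t ltac:(lra) l0); auto. }
    destruct Hroot as [l0 [Hl0 Hre]].
    assert (Htp : 0 < t).
    { destruct (proj1 Ht) as [? | Heq]; [assumption |].
      rewrite <- Heq in Hl0; specialize (H0 l0 Hl0); lra. }
    destruct (unstable_root_persists a2 a1 a0 b1 b0 t l0 (proj1 Ht) Hl0 Hre) as [d [Hd Hper]].
    set (tau := Rmax 0 (t - d / 2)).
    assert (Htau : 0 <= tau < t) by (split; [apply Rmax_l | apply Rmax_lub_lt; lra]).
    assert (Hmax : t - d / 2 <= tau) by apply Rmax_r.
    clearbody tau.
    assert (Hdt : Rabs (tau - t) < d) by (rewrite Rabs_left; lra).
    destruct (Hper tau (proj1 Htau) Hdt) as [l1 [Hl1 Hre1]].
    assert (Hun : ~ all_roots_neg a2 a1 a0 b1 b0 tau) by (intro Hs; specialize (Hs l1 Hl1); lra).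
    assert (HtT : 0 <= tau < T) by lra.
    specialize (Hlow tau (conj HtT Hun)); lra.
Qed.

(** * Roots on the imaginary axis *)

(** For [l = x + i y] with [y <> 0] the imaginary part gives
    [y^2 = 3 x^2 + 2 p2 x + p1]; the real part then becomes a cubic in [x]
    that is negative for [x >= 0]. *)
Lemma cubic_routh_hurwitz (p2 p1 p0 : R) (l : C) :
  0 < p2 -> 0 < p0 -> 0 < p2 * p1 - p0 ->
  (l * l * l + RtoC p2 * (l * l) + RtoC p1 * l + RtoC p0)%C = 0%C -> Re l < 0.
Proof.
  intros Hp2 Hp0 Hrh; destruct l as [x y]; unfold Re; cbn [fst].
  unfold Cmult, Cplus, RtoC; cbn [fst snd]; intro H; injection H as Hre Him.
  assert (Hp1 : 0 < p1) by (apply Rnot_le_lt; intro; nra).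
  apply Rnot_le_lt; intro Hx.
  destruct (Req_dec y 0) as [-> | Hy].
  - assert (0 <= x * x * x) by (apply Rmult_le_pos; nra). nra.
  - assert (Hy2 : y * y = 3 * x * x + 2 * p2 * x + p1)
      by (apply (Rmult_eq_reg_l y); [nra | exact Hy]).
    assert (E : -8 * x * x * x - 8 * p2 * x * x - 2 * (p1 + p2 * p2) * x + (p0 - p2 * p1) = 0).
    { assert (x * (y * y) = x * (3 * x * x + 2 * p2 * x + p1)) by (rewrite Hy2; ring).
      assert (p2 * (y * y) = p2 * (3 * x * x + 2 * p2 * x + p1)) by (rewrite Hy2; ring).
      nra. }
    assert (0 <= x * x * x) by (apply Rmult_le_pos; nra). nra.
Qed.

Lemma charf_tau0 (a2 a1 a0 b1 b0 : R) (l : C) :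
  charf a2 a1 a0 b1 b0 0 l
  = (l * l * l + RtoC a2 * (l * l) + RtoC (a1 + b1) * l + RtoC (a0 + b0))%C.
Proof.
  unfold charf.
  replace (Cexp (- (l * RtoC 0))) with (RtoC 1).
  - rewrite !RtoC_plus; ring.
  - destruct l as [x y]; unfold Cexp, Cmult, Copp, RtoC, Re, Im; cbn [fst snd].
    replace (- (x * 0 - y * 0)) with 0 by ring; replace (- (x * 0 + y * 0)) with 0 by ring.
    rewrite exp_0, cos_0, sin_0, Rmult_0_r, Rmult_1_r; reflexivity.
Qed.

Lemma all_roots_neg_tau0 (a2 a1 a0 b1 b0 : R) :
  0 < a2 -> 0 < a0 + b0 -> 0 < a2 * (a1 + b1) - (a0 + b0) -> all_roots_neg a2 a1 a0 b1 b0 0.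
Proof.
  intros Ha2 Hc0 Hrh l Hl; rewrite charf_tau0 in Hl.
  exact (cubic_routh_hurwitz _ _ _ l Ha2 Hc0 Hrh Hl).
Qed.

Lemma charf_imag (a2 a1 a0 b1 b0 tau y : R) :
  charf a2 a1 a0 b1 b0 tau (0, y) =
  (a0 - a2 * y ^ 2 + b0 * cos (y * tau) + b1 * y * sin (y * tau),
   a1 * y - y ^ 3 + b1 * y * cos (y * tau) - b0 * sin (y * tau)).
Proof.
  unfold charf, Cexp, Re, Im, Cmult, Cplus, Copp, RtoC; cbn [fst snd].
  replace (- (0 * tau - y * 0)) with 0 by ring.
  replace (- (0 * 0 + y * tau)) with (- (y * tau)) by ring.
  rewrite exp_0, cos_neg, sin_neg; f_equal; ring.
Qed.

Lemma charf_at_0 (a2 a1 a0 b1 b0 tau : R) :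
  0 < a0 + b0 -> charf a2 a1 a0 b1 b0 tau (0, 0) <> 0%C.
Proof.
  intros Hpos H; rewrite charf_imag in H; pose proof (f_equal fst H) as F.
  unfold RtoC in F; cbn [fst] in F; rewrite Rmult_0_l, cos_0, sin_0 in F; lra.
Qed.

(** Squaring and adding the real and imaginary parts at [l = i y] eliminates
    the delay: [y^2] is then a root of [z^3 + A z^2 + B z + C]. *)
Lemma imaginary_root_hcubic (a2 a1 a0 b1 b0 tau y : R) :
  charf a2 a1 a0 b1 b0 tau (0, y) = 0%C ->
  hcubic (cA a2 a1) (cB a2 a1 a0 b1) (cC a0 b0) (y ^ 2) = 0.
Proof.
  rewrite charf_imag; intro H; injection H as F1 F2.
  pose proof (sin2_cos2 (y * tau)) as Hsc; unfold Rsqr in Hsc.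
  set (c := cos (y * tau)) in *; set (s := sin (y * tau)) in *.
  unfold hcubic, cA, cB, cC.
  replace ((y ^ 2) ^ 3 + (a2 ^ 2 - 2 * a1) * (y ^ 2) ^ 2 + (a1 ^ 2 - 2 * a2 * a0 - b1 ^ 2) * y ^ 2
           + (a0 ^ 2 - b0 ^ 2))
    with ((a0 - a2 * y ^ 2) ^ 2 + (a1 * y - y ^ 3) ^ 2 - (b0 ^ 2 + b1 ^ 2 * y ^ 2) * (s * s + c * c))
    by (rewrite Hsc; ring).
  replace (a0 - a2 * y ^ 2) with (- (b0 * c + b1 * y * s)) by lra.
  replace (a1 * y - y ^ 3) with (- (b1 * y * c - b0 * s)) by lra.
  ring.
Qed.

Lemma imaginary_root_cos (a2 a1 a0 b1 b0 tau y : R) :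
  charf a2 a1 a0 b1 b0 tau (0, y) = 0%C ->
  cos (y * tau) * (b0 ^ 2 + b1 ^ 2 * y ^ 2)
  = b0 * (a2 * y ^ 2 - a0) + b1 * y * (y ^ 3 - a1 * y).
Proof.
  rewrite charf_imag; intro H.
  pose proof (f_equal fst H) as F1; pose proof (f_equal snd H) as F2.
  unfold RtoC in F1, F2; cbn [fst snd] in F1, F2.
  set (c := cos (y * tau)) in *; set (s := sin (y * tau)) in *.
  transitivity (b0 * (a2 * y ^ 2 - a0 + (a0 - a2 * y ^ 2 + b0 * c + b1 * y * s))
                + b1 * y * (y ^ 3 - a1 * y + (a1 * y - y ^ 3 + b1 * y * c - b0 * s)));
    [ring | rewrite F1, F2; ring].
Qed.

Lemma hcubic_pos_of_Delta_neg (A B C z : R) :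
  cDelta A B < 0 -> 0 <= C -> 0 < z -> 0 < hcubic A B C z.
Proof.
  unfold cDelta, hcubic; intros HD HC Hz.
  assert (Hq : 0 < z * z + A * z + B)
    by (pose proof (pow2_ge_0 (2 * z + A)); nra).
  assert (0 < z * (z * z + A * z + B)) by nra.
  nra.
Qed.

Lemma all_roots_neg_of_Delta_neg (a2 a1 a0 b1 b0 : R) :
  0 < a2 -> 0 < a0 + b0 -> 0 < a2 * (a1 + b1) - (a0 + b0) ->
  0 <= cC a0 b0 -> cDelta (cA a2 a1) (cB a2 a1 a0 b1) < 0 ->
  forall tau, 0 <= tau -> all_roots_neg a2 a1 a0 b1 b0 tau.
Proof.
  intros Ha2 Hpos Hrh HC HD tau Htau.
  apply (all_roots_neg_until_crossing a2 a1 a0 b1 b0 (tau + 1));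
    [apply all_roots_neg_tau0; auto | | lra].
  intros t _ [x y] Hre Hl; unfold Re in Hre; cbn [fst] in Hre; subst x.
  destruct (Req_dec y 0) as [-> | Hy]; [exact (charf_at_0 _ _ _ _ _ t Hpos Hl) |].
  pose proof (imaginary_root_hcubic _ _ _ _ _ _ _ Hl) as Hh.
  pose proof (hcubic_pos_of_Delta_neg _ _ _ (y ^ 2) HD HC ltac:(apply pow2_gt_0, Hy)).
  lra.
Qed.

(** If [C < 0 < A], a second positive root [z] would force
    [C = z z0 (z + z0 + A) > 0]. *)
Lemma hcubic_pos_root_unique (A B C z z0 : R) :
  0 < A -> C < 0 -> 0 < z -> 0 < z0 ->
  hcubic A B C z = 0 -> hcubic A B C z0 = 0 -> z = z0.
Proof.
  unfold hcubic; intros HA HC Hz Hz0 Hh Hh0.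
  destruct (Req_dec z z0) as [E | Hne]; [exact E | exfalso].
  assert (HB : B = - (z * z + z * z0 + z0 * z0 + A * (z + z0))).
  { apply (Rmult_eq_reg_l (z - z0)); [| lra].
    transitivity ((z ^ 3 + A * z ^ 2 + B * z + C) - (z0 ^ 3 + A * z0 ^ 2 + B * z0 + C)
                  - (z - z0) * (z * z + z * z0 + z0 * z0 + A * (z + z0))); [ring |].
    rewrite Hh, Hh0; ring. }
  assert (HCv : C = z0 * z * (z0 + z + A)).
  { replace C with (- (z0 ^ 3 + A * z0 ^ 2 + B * z0)) by lra; rewrite HB; ring. }
  assert (0 < z0 * z) by nra.
  assert (0 < z0 * z * (z0 + z + A)) by (apply Rmult_lt_0_compat; lra).
  lra.
Qed.

Lemma cos_gt_of_lt_acos (X th : R) : -1 <= X <= 1 -> 0 <= th < acos X -> X < cos th.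
Proof.
  intros HX Hth; pose proof (acos_bound X) as [_ Hpi].
  rewrite <- (cos_acos X HX) at 1; apply cos_decreasing_1; lra.
Qed.

Lemma imaginary_root_delay_coeff_pos (a2 a1 a0 b1 b0 tau y : R) :
  0 < a2 * (a1 + b1) - (a0 + b0) -> y <> 0 -> charf a2 a1 a0 b1 b0 tau (0, y) = 0%C ->
  0 < b0 ^ 2 + b1 ^ 2 * y ^ 2.
Proof.
  intros Hrh Hy Hl; rewrite charf_imag in Hl.
  pose proof (f_equal fst Hl) as F1; pose proof (f_equal snd Hl) as F2; clear Hl.
  unfold RtoC in F1, F2; cbn [fst snd] in F1, F2.
  pose proof (pow2_ge_0 b0); pose proof (pow2_ge_0 b1); pose proof (pow2_gt_0 y Hy).
  destruct (Req_dec (b0 ^ 2 + b1 ^ 2 * y ^ 2) 0) as [HD | HD]; [exfalso | nra].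
  assert (Hb0 : b0 = 0) by nra.
  assert (Hb1 : b1 = 0).
  { assert (Hprod : b1 ^ 2 * y ^ 2 = 0) by (rewrite Hb0 in HD; lra).
    apply Rmult_integral in Hprod; destruct Hprod as [Hp | Hp];
      [apply NNPP; intro Hb1; exact (pow_nonzero b1 2 Hb1 Hp)
      | destruct (pow_nonzero y 2 Hy Hp)]. }
  rewrite Hb0, Hb1 in F1, F2, Hrh.
  assert (Ha1 : a1 = y ^ 2) by (apply (Rmult_eq_reg_l y); [nra | exact Hy]).
  nra.
Qed.

(** At a root [i y], [cos (|y| tau)] equals the argument of [acos] in [tau0]
    with [w0 = |y|]; as [cos] decreases on [[0, pi]], [|y| tau >= acos _]. *)
Lemma imaginary_root_delay_ge_tau0 (a2 a1 a0 b1 b0 t y : R) :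
  0 < a2 * (a1 + b1) - (a0 + b0) -> 0 <= t -> y <> 0 ->
  charf a2 a1 a0 b1 b0 t (0, y) = 0%C -> tau0_of a2 a1 a0 b1 b0 (Rabs y) <= t.
Proof.
  intros Hrh Ht Hy Hl.
  pose proof (imaginary_root_delay_coeff_pos _ _ _ _ _ _ _ Hrh Hy Hl) as HD.
  pose proof (imaginary_root_cos _ _ _ _ _ _ _ Hl) as Hcos; clear Hl.
  set (w0 := Rabs y).
  assert (Hw0 : 0 < w0) by (apply Rabs_pos_lt, Hy).
  assert (Hw2 : w0 ^ 2 = y ^ 2) by (unfold w0; rewrite <- !Rsqr_pow2; symmetry; apply Rsqr_abs).
  set (X := (b0 * (a2 * w0 ^ 2 - a0) + b1 * w0 * (w0 ^ 3 - a1 * w0))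
            / (b0 ^ 2 + b1 ^ 2 * w0 ^ 2)).
  assert (HcosX : cos (w0 * t) = X).
  { assert (Hcy : cos (y * t) = cos (w0 * t)).
    { unfold w0, Rabs; destruct (Rcase_abs y); [| reflexivity].
      replace (- y * t) with (- (y * t)) by ring; rewrite cos_neg; reflexivity. }
    rewrite <- Hcy; unfold X.
    replace (b1 * w0 * (w0 ^ 3 - a1 * w0)) with (b1 * ((w0 ^ 2) ^ 2 - a1 * w0 ^ 2)) by ring.
    rewrite Hw2; apply (Rmult_eq_reg_r (b0 ^ 2 + b1 ^ 2 * y ^ 2)); [| lra].
    rewrite Hcos; field; lra. }
  assert (HX : -1 <= X <= 1) by (rewrite <- HcosX; apply COS_bound).
  apply Rnot_lt_le; intro Ht1.
  assert (Hwt : 0 <= w0 * t < acos X).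
  { split; [nra |]; unfold tau0_of in Ht1; fold X in Ht1.
    apply (Rmult_lt_compat_l w0) in Ht1; [| exact Hw0].
    rewrite <- Rmult_assoc, Rinv_r, Rmult_1_l in Ht1 by lra; exact Ht1. }
  pose proof (cos_gt_of_lt_acos X (w0 * t) HX Hwt); lra.
Qed.

Lemma all_roots_neg_below_tau0 (a2 a1 a0 b1 b0 z0 : R) :
  0 < a2 -> 0 < a0 + b0 -> 0 < a2 * (a1 + b1) - (a0 + b0) ->
  0 < cA a2 a1 -> cC a0 b0 < 0 ->
  0 < z0 -> hcubic (cA a2 a1) (cB a2 a1 a0 b1) (cC a0 b0) z0 = 0 ->
  forall tau, 0 <= tau < tau0_of a2 a1 a0 b1 b0 (sqrt z0) -> all_roots_neg a2 a1 a0 b1 b0 tau.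
Proof.
  intros Ha2 Hpos Hrh HA HC Hz0 Hh0 tau Htau.
  apply (all_roots_neg_until_crossing a2 a1 a0 b1 b0 (tau0_of a2 a1 a0 b1 b0 (sqrt z0)));
    [apply all_roots_neg_tau0; auto | | exact Htau].
  intros t [Ht0 Ht1] [x y] Hre Hl; unfold Re in Hre; cbn [fst] in Hre; subst x.
  destruct (Req_dec y 0) as [-> | Hy]; [exact (charf_at_0 _ _ _ _ _ t Hpos Hl) |].
  assert (Hy2 : y ^ 2 = z0)
    by (apply (hcubic_pos_root_unique _ (cB a2 a1 a0 b1) _ _ _ HA HC (pow2_gt_0 _ Hy) Hz0);
        [exact (imaginary_root_hcubic _ _ _ _ _ _ _ Hl) | exact Hh0]).
  assert (Hw : sqrt z0 = Rabs y) by (rewrite <- Hy2, <- Rsqr_pow2; apply sqrt_Rsqr_abs).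
  pose proof (imaginary_root_delay_ge_tau0 _ _ _ _ _ _ _ Hrh Ht0 Hy Hl).
  rewrite Hw in Ht1; lra.
Qed.

Lemma cz1_nonpos (A B : R) : 0 <= A -> 0 <= B -> cz1 A (cDelta A B) <= 0.
Proof.
  intros HA HB; unfold cz1, cDelta.
  assert (sqrt (A ^ 2 - 3 * B) <= A).
  { rewrite <- (sqrt_pow2 A HA) at 2; apply sqrt_le_1_alt; lra. }
  lra.
Qed.

(** With [sg = s / T2],
    [g = b T2 V2 / ((1 + alpha V2) I2)] and [th = 1 / (1 + alpha V2)] the
    equilibrium relations read [A11 = sg + k], [A22 = g + q],
    [p m = ka g th] and [be k = g q]. *)
Section ModelCoefficients.
Variables (sg k q g ka be th : R).
Hypotheses (Hsg : 0 < sg) (Hk : 0 < k) (Hq : 0 < q) (Hg : 0 < g) (Hka : 0 < ka)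
  (Hbe : 0 < be) (Hth : 0 < th < 1).

Let a2 := sg + k + (g + q) + ka.
Let a1 := (sg + k) * (g + q) + ka * (sg + k) + ka * (g + q) - k * q.
Let a0 := ka * (sg + k) * (g + q) - ka * k * q - q * (ka * g * th).
Let b1 := g * q - ka * g * th.
Let b0 := g * q * ka + be * (ka * g * th) - ka * g * th * (sg + k).

Lemma model_cA_pos : 0 < cA a2 a1.
Proof.
  unfold cA, a2, a1.
  replace ((sg + k + (g + q) + ka) ^ 2
           - 2 * ((sg + k) * (g + q) + ka * (sg + k) + ka * (g + q) - k * q))
    with ((sg + k) ^ 2 + (g + q) ^ 2 + ka ^ 2 + 2 * k * q) by ring.
  pose proof (pow2_ge_0 (sg + k)); pose proof (pow2_ge_0 (g + q)); pose proof (pow2_ge_0 ka).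
  nra.
Qed.

(** From [C >= 0] and [a0 + b0 > 0] we get [a0 >= b0], i.e. [q g <= X] below;
    then [B = X^2 - (q g)^2 + (a sum of nonnegative monomials)]. *)
Lemma model_cB_nonneg : 0 < a0 + b0 -> 0 <= cC a0 b0 -> 0 <= cB a2 a1 a0 b1.
Proof.
  intros Hs HC; unfold cC in HC.
  assert (Hd : 0 <= a0 - b0).
  { apply Rnot_lt_le; intro.
    assert (a0 ^ 2 - b0 ^ 2 = (a0 - b0) * (a0 + b0)) by ring; nra. }
  assert (Hin : 0 <= (1 + th) * (sg + k) * g - (1 + th) * q * g + sg * q - be * g * th).
  { replace (a0 - b0)
      with (ka * ((1 + th) * (sg + k) * g - (1 + th) * q * g + sg * q - be * g * th))
      in Hd by (unfold a0, b0; ring).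
    apply Rnot_lt_le; intro; nra. }
  set (X := (sg + k) * g + sg * q).
  assert (Hqg : q * g <= X).
  { assert (0 <= be * g * th) by (repeat apply Rmult_le_pos; lra).
    assert (0 <= sg * q * th) by (repeat apply Rmult_le_pos; lra).
    unfold X; nra. }
  assert (HX : (q * g) ^ 2 <= X ^ 2) by (assert (0 <= q * g) by nra; nra).
  set (Rr := ka ^ 2 * g ^ 2 * (1 - th ^ 2) + 4 * q * ka * th * g ^ 2 + 2 * q * ka ^ 2 * g
     + 2 * q * ka ^ 2 * th * g + 2 * q ^ 2 * ka * th * g + q ^ 2 * ka ^ 2
     + 2 * k * q * ka * th * g + 2 * k * q * ka ^ 2 + k ^ 2 * ka ^ 2
     + 2 * sg * q * ka * th * g + 2 * sg * k * ka ^ 2 + sg ^ 2 * ka ^ 2).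
  assert (HR : 0 <= Rr).
  { assert (0 <= 1 - th ^ 2) by nra.
    unfold Rr; repeat apply Rplus_le_le_0_compat; repeat apply Rmult_le_pos; nra. }
  replace (cB a2 a1 a0 b1) with (X ^ 2 - (q * g) ^ 2 + Rr)
    by (unfold cB, a2, a1, a0, b1, X, Rr; ring).
  lra.
Qed.
End ModelCoefficients.

Lemma model_coeffs_reparam (A11v A22v ka k q be m p sg g th : R) :
  A11v = sg + k -> A22v = g + q -> p * m = ka * g * th -> be * k = g * q ->
  0 < sg -> 0 < k -> 0 < q -> 0 < g -> 0 < ka -> 0 < be -> 0 < th < 1 ->
  let a2 := A11v + A22v + ka in
  let a1 := A11v * A22v + ka * A11v + ka * A22v - k * q in
  let a0 := ka * A11v * A22v - ka * k * q - p * q * m in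
  let b1 := be * k - p * m in
  let b0 := be * k * ka + be * p * m - p * m * A11v in
  0 < a2 /\ 0 < cA a2 a1 /\ (0 < a0 + b0 -> 0 <= cC a0 b0 -> 0 <= cB a2 a1 a0 b1).
Proof.
  intros -> -> Hpm Hbk Hsg Hk Hq Hg Hka Hbe Hth a2 a1 a0 b1 b0.
  assert (Ea0 : a0 = ka * (sg + k) * (g + q) - ka * k * q - q * (ka * g * th))
    by (unfold a0; rewrite <- Hpm; ring).
  assert (Eb1 : b1 = g * q - ka * g * th) by (unfold b1; rewrite <- Hpm, Hbk; ring).
  assert (Eb0 : b0 = g * q * ka + be * (ka * g * th) - ka * g * th * (sg + k))
    by (unfold b0; rewrite <- Hpm, <- Hbk; ring).
  rewrite Ea0, Eb1, Eb0; split; [unfold a2; lra |].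
  split; [apply model_cA_pos | apply model_cB_nonneg]; assumption.
Qed.

Lemma model_coeff_signs (s d a Tmax b alpha p T2 I2 V2 : R) :
  0 < s -> 0 < a -> 0 < Tmax -> 0 < b -> 0 < alpha -> 0 < p -> 0 < T2 -> 0 < I2 -> 0 < V2 ->
  s - d * T2 + a * T2 * (1 - (T2 + I2) / Tmax) - b * T2 * V2 / (1 + alpha * V2) = 0 ->
  let a2 := ca2 d a Tmax b alpha p T2 I2 V2 in
  let a1 := ca1 d a Tmax b alpha p T2 I2 V2 in
  let a0 := ca0 d a Tmax b alpha p T2 I2 V2 in
  let b1 := cb1 d a Tmax b alpha p T2 I2 V2 in
  let b0 := cb0 d a Tmax b alpha p T2 I2 V2 in
  0 < a2 /\ 0 < cA a2 a1 /\ (0 < a0 + b0 -> 0 <= cC a0 b0 -> 0 <= cB a2 a1 a0 b1).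
Proof.
  intros hs ha hTmax hb halpha hp hT2 hI2 hV2 eqT.
  assert (hq1 : 0 < 1 + alpha * V2) by nra.
  apply (model_coeffs_reparam _ _ _ _ _ _ _ p (s / T2) (b * T2 * V2 / ((1 + alpha * V2) * I2))
           (1 / (1 + alpha * V2))).
  - unfold A11, crho, cbeta.
    enough (E : d - a + a * (T2 + I2) / Tmax + b * V2 / (1 + alpha * V2) = s / T2) by lra.
    apply (Rmult_eq_reg_r T2); [| lra].
    transitivity (s - (s - d * T2 + a * T2 * (1 - (T2 + I2) / Tmax)
                       - b * T2 * V2 / (1 + alpha * V2))); [field; lra |].
    rewrite eqT; field; lra.
  - reflexivity.
  - unfold cm, ckappa; field; lra.
  - unfold cbeta, ck, cq; field; lra.
  - apply Rdiv_lt_0_compat; lra.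
  - unfold ck; apply Rdiv_lt_0_compat; nra.
  - unfold cq; apply Rdiv_lt_0_compat; nra.
  - apply Rdiv_lt_0_compat; [| apply Rmult_lt_0_compat]; try lra.
    apply Rmult_lt_0_compat; [apply Rmult_lt_0_compat |]; lra.
  - unfold ckappa; apply Rdiv_lt_0_compat; nra.
  - unfold cbeta; apply Rdiv_lt_0_compat; nra.
  - split; [apply Rdiv_lt_0_compat; lra |].
    apply (Rmult_lt_reg_r (1 + alpha * V2)); [lra |].
    replace (1 / (1 + alpha * V2) * (1 + alpha * V2)) with 1 by (field; lra); nra.
Qed.

Theorem theorem2
  (s d a Tmax b alpha mu p c : R) (T2 I2 V2 : R)
  (hs : 0 < s) (hd : 0 < d) (ha : 0 < a) (hTmax : 0 < Tmax) (hb : 0 < b)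
  (halpha : 0 < alpha) (hmu : 0 < mu) (hp : 0 < p) (hc : 0 < c)
  (hT2 : 0 < T2) (hI2 : 0 < I2) (hV2 : 0 < V2)
  (eqT : s - d * T2 + a * T2 * (1 - (T2 + I2) / Tmax)
           - b * T2 * V2 / (1 + alpha * V2) = 0)
  (eqI : b * T2 * V2 / (1 + alpha * V2) + a * I2 * (1 - (T2 + I2) / Tmax)
           - mu * I2 = 0)
  (eqV : p * I2 - c * V2 = 0) :
  let a2 := ca2 d a Tmax b alpha p T2 I2 V2 in
  let a1 := ca1 d a Tmax b alpha p T2 I2 V2 in
  let a0 := ca0 d a Tmax b alpha p T2 I2 V2 in
  let b1 := cb1 d a Tmax b alpha p T2 I2 V2 in
  let b0 := cb0 d a Tmax b alpha p T2 I2 V2 in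
  let A := cA a2 a1 in
  let B := cB a2 a1 a0 b1 in
  let C := cC a0 b0 in
  let Delta := cDelta A B in
  0 < a0 + b0 ->
  0 < a2 * (a1 + b1) - (a0 + b0) ->
  (* (a) *)
  ((0 <= C -> Delta < 0 -> forall tau, 0 <= tau -> all_roots_neg a2 a1 a0 b1 b0 tau)
  /\
  (* (b) *)
   ((C < 0 \/ (0 <= C /\ 0 <= Delta /\ 0 < cz1 A Delta
                 /\ hcubic A B C (cz1 A Delta) <= 0)) ->
    forall z0 : R, 0 < z0 -> hcubic A B C z0 = 0 ->
    (forall z, 0 < z < z0 -> hcubic A B C z <> 0) ->
    let w0 := sqrt z0 in
    let tau0 := tau0_of a2 a1 a0 b1 b0 w0 in
    forall tau, 0 <= tau < tau0 -> all_roots_neg a2 a1 a0 b1 b0 tau)).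
Proof.
  intros a2 a1 a0 b1 b0 A B C Delta Hpos Hrh.
  destruct (model_coeff_signs s d a Tmax b alpha p T2 I2 V2
              hs ha hTmax hb halpha hp hT2 hI2 hV2 eqT)
    as [Ha2 [HA HB]].
  split.
  - intros HC HD; exact (all_roots_neg_of_Delta_neg a2 a1 a0 b1 b0 Ha2 Hpos Hrh HC HD).
  - intros Hcase z0 Hz0 Hh0 _ w0 tau0.
    assert (HC : C < 0).
    { destruct Hcase as [HC | [HC [_ [Hz1 _]]]]; [exact HC |].
      pose proof (cz1_nonpos A B (Rlt_le _ _ HA) (HB Hpos HC)) as Hz1'.
      fold Delta in Hz1'; lra. }
    exact (all_roots_neg_below_tau0 a2 a1 a0 b1 b0 z0 Ha2 Hpos Hrh HA HC Hz0 Hh0).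
Qed.
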